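(* Let $\alpha>0$, $\beta>0$, $\gamma\ge 0$, $a>0$, $b>0$, let $\lambda\in\mathbb{R}$, let $n>2$ be an integer and let $B(u)=-u^n$. Let $u_0\in A_\lambda(\mathbb{R})$, and let $u\in C([0,T^*(u_0)),C_{\mathrm u}(\mathbb{R}))$ be the maximal mild solution of $$\partial_t u=(\alpha+i\beta)\partial_{xx}u+\gamma u+(a+ib)B(u),\qquad u(0)=u_0 .$$ Then $u(t)\in A_\lambda(\mathbb{R})$ for all $t\in(0,T^*(u_0))$.
   Context: $C_{\mathrm u}(\mathbb{R})$ is the Banach space of bounded uniformly continuous functions $u:\mathbb{R}\to\mathbb{C}$ with norm $\|u\|_\infty=\sup_{x\in\mathbb{R}}|u(x)|$. For $\lambda\in\mathbb{R}$, $A_\lambda(\mathbb{R})$ is the set of $u\in C_{\mathrm u}(\mathbb{R})$ for which there are $a_j\in\mathbb{C}$ ($j\ge1$) with $\sum_{j=1}^\infty|a_j|<\infty$ and $u(x)=\sum_{j=1}^\infty a_je^{ixj\lambda}$ for all $x\in\mathbb{R}$. $U(t)$ is the one-parameter semigroup on $C_{\mathrm u}(\mathbb{R})$ solving the linear equation $\partial_t u=(\alpha+i\beta)\partial_{xx}u+\gamma u$: $U(0)$ is the identity and, for $t>0$, $U(t)v=G_t*v$ (convolution in $x$) with $G_t(x)=(4\pi t(\alpha+i\beta))^{-1/2}\exp\left(-\frac{x^2}{4t(\alpha+i\beta)}+\gamma t\right)$, using the principal branch of the square root. A function $u\in C([0,T],C_{\mathrm u}(\mathbb{R}))$ is a mild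 solution of the equation on $[0,T]$ if $u(t)=U(t)u_0+(a+ib)\int_0^tU(t-t')B(u(t'))\,dt'$ for all $t\in[0,T]$. A function in $C([0,T^* ),C_{\mathrm u}(\mathbb{R}))$ is a mild solution if it is one on $[0,T]$ for every $T<T^*$. For every $u_0\in C_{\mathrm u}(\mathbb{R})$ there is a unique maximal mild solution, defined on $[0,T^*(u_0))$, where $T^*(u_0)\in(0,\infty]$ and, if $T^*(u_0)<\infty$, then $\|u(t)\|_\infty\to\infty$ as $t\uparrow T^*(u_0)$. *)

(* Defs.v *)
From Stdlib Require Import Reals Lra FunctionalExtensionality ProofIrrelevance
  PropExtensionality ClassicalEpsilon.
From Coquelicot Require Import Coquelicot.
Open Scope R_scope.

Definition Cexp (z : C) : C :=
  (exp (fst z) * cos (snd z), exp (fst z) * sin (snd z)).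

Lemma Cmod_Cexp (z : C) : Cmod (Cexp z) = exp (fst z).
Proof.
unfold Cmod, Cexp; simpl.
replace (_ + _) with (exp (fst z) * exp (fst z) * (Rsqr (sin (snd z)) + Rsqr (cos (snd z))))
  by (unfold Rsqr; ring).
rewrite sin2_cos2, Rmult_1_r.
apply sqrt_square, Rlt_le, exp_pos.
Qed.

(** The branch cut is the negative real axis, on which the value is [i sqrt |z|];
    see [Csqrt_square], [Csqrt_Re_pos]. *)
Definition Csqrt (z : C) : C :=
  (sqrt ((Cmod z + fst z) / 2),
   (if Rle_dec 0 (snd z) then 1 else -1) * sqrt ((Cmod z - fst z) / 2)).

Lemma Cmod_ge_Re (z : C) : Rabs (fst z) <= Cmod z.
Proof.
eapply Rle_trans; [apply Rmax_l | apply Rmax_Cmod].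
Qed.

Lemma Csqrt_square (z : C) : (Csqrt z * Csqrt z)%C = z.
Proof.
assert (Hr := Cmod_ge_Re z).
assert (H1 : fst z <= Cmod z) by (eapply Rle_trans; [apply Rle_abs | exact Hr]).
assert (H2 : - fst z <= Cmod z)
  by (eapply Rle_trans; [apply Rle_abs | rewrite Rabs_Ropp; exact Hr]).
assert (Hp : 0 <= (Cmod z + fst z) / 2) by lra.
assert (Hm : 0 <= (Cmod z - fst z) / 2) by lra.
assert (Hprod : sqrt ((Cmod z + fst z) / 2) * sqrt ((Cmod z - fst z) / 2)
  = Rabs (snd z) / 2).
{ rewrite <- sqrt_mult by assumption.
  replace ((Cmod z + fst z) / 2 * ((Cmod z - fst z) / 2))
    with (Rsqr (snd z / 2)).
  - rewrite sqrt_Rsqr_abs. unfold Rdiv. rewrite Rabs_mult.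
    rewrite (Rabs_right (/2)) by lra. reflexivity.
  - assert (Cmod z * Cmod z = fst z ^ 2 + snd z ^ 2).
    { unfold Cmod. apply sqrt_sqrt. nra. }
    unfold Rsqr. nra. }
assert (Sp := sqrt_sqrt _ Hp). assert (Sm := sqrt_sqrt _ Hm).
unfold Csqrt.
set (p := sqrt ((Cmod z + fst z) / 2)) in *.
set (m := sqrt ((Cmod z - fst z) / 2)) in *.
destruct z as [x y]; unfold Cmult; simpl in *.
destruct (Rle_dec 0 y) as [Hy | Hy].
- rewrite Rabs_right in Hprod by lra. f_equal; nra.
- rewrite Rabs_left in Hprod by lra. f_equal; nra.
Qed.

Lemma Csqrt_Re_pos (z : C) : 0 < fst z \/ snd z <> 0 -> 0 < fst (Csqrt z).
Proof.
intros H; simpl; apply sqrt_lt_R0.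
assert (0 < Cmod z + fst z); [|lra].
assert (Hn : 0 <= Cmod z) by apply Cmod_ge_0.
destruct H as [H | H]; [lra|].
assert (Cmod z * Cmod z = fst z ^ 2 + snd z ^ 2).
{ unfold Cmod. apply sqrt_sqrt. nra. }
assert (0 < snd z * snd z) by nra.
destruct (Rlt_dec 0 (fst z)); nra.
Qed.

Definition is_Cu (f : R -> C) : Prop :=
  (exists M : R, forall x, Cmod (f x) <= M) /\
  (forall eps : posreal, exists delta : posreal,
     forall x y, Rabs (x - y) < delta -> Cmod (f x - f y)%C < eps).

Record Cu := mkCu { Cu_fun :> R -> C; Cu_is_Cu : is_Cu Cu_fun }.

Lemma Cu_ext (u v : Cu) : (forall x, u x = v x) -> u = v.
Proof.
destruct u as [f hf], v as [g hg]; simpl; intros H.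
assert (f = g) by (apply functional_extensionality; exact H); subst g.
f_equal; apply proof_irrelevance.
Qed.

Lemma is_Cu_const (c : C) : is_Cu (fun _ => c).
Proof.
split.
- exists (Cmod c); intros; apply Rle_refl.
- intros eps; exists (mkposreal 1 Rlt_0_1); intros x y _.
  replace (c - c)%C with (RtoC 0) by ring.
  rewrite Cmod_0; apply cond_pos.
Qed.

Lemma is_Cu_plus (f g : R -> C) :
  is_Cu f -> is_Cu g -> is_Cu (fun x => f x + g x)%C.
Proof.
intros [[M hM] hf] [[N hN] hg]; split.
- exists (M + N); intros x.
  eapply Rle_trans; [apply Cmod_triangle|].
  apply Rplus_le_compat; auto.
- intros eps.
  destruct (hf (pos_div_2 eps)) as [d1 h1].
  destruct (hg (pos_div_2 eps)) as [d2 h2].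
  exists (mkposreal _ (Rmin_stable_in_posreal d1 d2)); simpl; intros x y hxy.
  replace (f x + g x - (f y + g y))%C with ((f x - f y) + (g x - g y))%C by ring.
  eapply Rle_lt_trans; [apply Cmod_triangle|].
  specialize (h1 x y (Rlt_le_trans _ _ _ hxy (Rmin_l _ _))).
  specialize (h2 x y (Rlt_le_trans _ _ _ hxy (Rmin_r _ _))).
  simpl in h1, h2; lra.
Qed.

Lemma is_Cu_mult (f g : R -> C) :
  is_Cu f -> is_Cu g -> is_Cu (fun x => f x * g x)%C.
Proof.
intros [[M hM] hf] [[N hN] hg]; split.
- exists (M * N); intros x. rewrite Cmod_mult.
  apply Rmult_le_compat; auto using Cmod_ge_0.
- intros eps.
  assert (HM : 0 <= M) by (eapply Rle_trans; [apply (Cmod_ge_0 (f 0)) | auto]).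
  assert (HN : 0 <= N) by (eapply Rle_trans; [apply (Cmod_ge_0 (g 0)) | auto]).
  assert (Hd : 0 < eps / (M + N + 1))
    by (apply Rdiv_lt_0_compat; [apply cond_pos | lra]).
  destruct (hf (mkposreal _ Hd)) as [d1 h1].
  destruct (hg (mkposreal _ Hd)) as [d2 h2].
  exists (mkposreal _ (Rmin_stable_in_posreal d1 d2)); simpl; intros x y hxy.
  replace (f x * g x - f y * g y)%C
    with (f x * (g x - g y) + (f x - f y) * g y)%C by ring.
  eapply Rle_lt_trans; [apply Cmod_triangle|].
  rewrite !Cmod_mult.
  specialize (h1 x y (Rlt_le_trans _ _ _ hxy (Rmin_l _ _))).
  specialize (h2 x y (Rlt_le_trans _ _ _ hxy (Rmin_r _ _))).
  simpl in h1, h2.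
  set (e := eps / (M + N + 1)) in *.
  assert (He : eps = e * (M + N + 1) :> R) by (unfold e; field; lra).
  rewrite He.
  assert (Cmod (f x) * Cmod (g x - g y) <= M * e)
    by (apply Rmult_le_compat; auto using Cmod_ge_0; lra).
  assert (Cmod (f x - f y) * Cmod (g y) <= e * N)
    by (apply Rmult_le_compat; auto using Cmod_ge_0; lra).
  lra.
Qed.

Lemma is_Cu_pow (f : R -> C) (n : nat) :
  is_Cu f -> is_Cu (fun x => Cpow (f x) n).
Proof.
intros hf; induction n as [|n IH].
- exact (is_Cu_const 1).
- exact (is_Cu_mult _ _ hf IH).
Qed.

Definition Cu_zero : Cu := mkCu _ (is_Cu_const 0).
Definition Cu_plus (u v : Cu) : Cu :=
  mkCu _ (is_Cu_plus _ _ (Cu_is_Cu u) (Cu_is_Cu v)).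
Definition Cu_scal (c : C) (u : Cu) : Cu :=
  mkCu _ (is_Cu_mult _ _ (is_Cu_const c) (Cu_is_Cu u)).
Definition Cu_opp (u : Cu) : Cu := Cu_scal (-1)%C u.
Definition Cu_pow (u : Cu) (n : nat) : Cu :=
  mkCu _ (is_Cu_pow _ n (Cu_is_Cu u)).

Definition Cu_norm (u : Cu) : R :=
  real (Lub_Rbar (fun r => exists x, r = Cmod (u x))).

Lemma Cu_norm_is_lub (u : Cu) :
  is_lub_Rbar (fun r => exists x, r = Cmod (u x)) (Finite (Cu_norm u)).
Proof.
unfold Cu_norm.
set (E := fun r => exists x, r = Cmod (u x)).
destruct (Lub_Rbar_correct E) as [H1 H2].
destruct (Cu_is_Cu u) as [[M hM] _].
assert (HM : Rbar_le (Lub_Rbar E) M) by (apply H2; intros r [x ->]; apply hM).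
assert (H0 : Rbar_le (Cmod (u 0)) (Lub_Rbar E)) by (apply H1; exists 0; reflexivity).
destruct (Lub_Rbar E); [split; assumption | easy | easy].
Qed.

Lemma Cu_norm_ub (u : Cu) (x : R) : Cmod (u x) <= Cu_norm u.
Proof.
destruct (Cu_norm_is_lub u) as [H _].
apply (H (Cmod (u x))); exists x; reflexivity.
Qed.

Lemma Cu_norm_le (u : Cu) (M : R) : (forall x, Cmod (u x) <= M) -> Cu_norm u <= M.
Proof.
intros hM; destruct (Cu_norm_is_lub u) as [_ H].
apply (H (Finite M)); intros r [x ->]; apply hM.
Qed.

Definition Cu_AbelianMonoid_mixin : AbelianMonoid.mixin_of Cu.
Proof.
refine (AbelianMonoid.Mixin Cu Cu_plus Cu_zero _ _ _);
  intros; apply Cu_ext; intros; simpl; ring.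
Defined.
Canonical Cu_AbelianMonoid := AbelianMonoid.Pack Cu Cu_AbelianMonoid_mixin Cu.

Definition Cu_AbelianGroup_mixin : AbelianGroup.mixin_of Cu_AbelianMonoid.
Proof.
refine (AbelianGroup.Mixin Cu_AbelianMonoid Cu_opp _).
intros u; apply Cu_ext; intros x; simpl; ring.
Defined.
Canonical Cu_AbelianGroup :=
  AbelianGroup.Pack Cu (AbelianGroup.Class _ _ Cu_AbelianGroup_mixin) Cu.

(** [Cu] is a complex Banach space; Coquelicot's vector-valued integral [RInt] uses
    its real structure, complex scalars act through [Cu_scal]. *)
Definition Cu_ModuleSpace_mixin : ModuleSpace.mixin_of R_Ring Cu_AbelianGroup.
Proof.
refine (ModuleSpace.Mixin R_Ring Cu_AbelianGroup (fun r u => Cu_scal (RtoC r) u)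
  _ _ _ _); intros; apply Cu_ext; intros z; simpl; unfold mult, plus, one; simpl;
  rewrite ?RtoC_mult, ?RtoC_plus; ring.
Defined.
Canonical Cu_ModuleSpace :=
  ModuleSpace.Pack R_Ring Cu (ModuleSpace.Class _ _ _ Cu_ModuleSpace_mixin) Cu.

Lemma Cu_norm_triangle (u v : Cu) : Cu_norm (Cu_plus u v) <= Cu_norm u + Cu_norm v.
Proof.
apply Cu_norm_le; intros x; simpl.
eapply Rle_trans; [apply Cmod_triangle|].
apply Rplus_le_compat; apply Cu_norm_ub.
Qed.

Lemma Cu_norm_scal (c : C) (u : Cu) : Cu_norm (Cu_scal c u) <= Cmod c * Cu_norm u.
Proof.
apply Cu_norm_le; intros x; simpl; rewrite Cmod_mult.
apply Rmult_le_compat_l; [apply Cmod_ge_0 | apply Cu_norm_ub].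
Qed.

Definition Cu_ball (u : Cu) (eps : R) (v : Cu) : Prop :=
  Cu_norm (Cu_plus v (Cu_opp u)) < eps.

Definition Cu_UniformSpace_mixin : UniformSpace.mixin_of Cu.
Proof.
refine (UniformSpace.Mixin Cu Cu_zero Cu_ball _ _ _); unfold Cu_ball.
- intros u e; eapply Rle_lt_trans; [|apply (cond_pos e)].
  apply Cu_norm_le; intros x; simpl.
  replace (u x + -1 * u x)%C with (RtoC 0) by ring.
  rewrite Cmod_0; apply Rle_refl.
- intros u v e H; eapply Rle_lt_trans; [|exact H].
  apply Cu_norm_le; intros x.
  replace (Cu_plus u (Cu_opp v) x) with (- Cu_plus v (Cu_opp u) x)%C
    by (simpl; ring).
  rewrite Cmod_opp; apply Cu_norm_ub.
- intros u v w e1 e2 H1 H2.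
  replace (Cu_plus w (Cu_opp u))
    with (Cu_plus (Cu_plus v (Cu_opp u)) (Cu_plus w (Cu_opp v)))
    by (apply Cu_ext; intros x; simpl; ring).
  eapply Rle_lt_trans; [apply Cu_norm_triangle | lra].
Defined.
Canonical Cu_UniformSpace := UniformSpace.Pack Cu Cu_UniformSpace_mixin Cu.

Canonical Cu_NormedModuleAux :=
  NormedModuleAux.Pack R_AbsRing Cu
    (NormedModuleAux.Class R_AbsRing Cu
      (ModuleSpace.class _ Cu_ModuleSpace) Cu_UniformSpace_mixin) Cu.

Definition Cu_NormedModule_mixin : NormedModule.mixin_of R_AbsRing Cu_NormedModuleAux.
Proof.
refine (NormedModule.Mixin R_AbsRing Cu_NormedModuleAux Cu_norm 1 _ _ _ _ _).
- exact Cu_norm_triangle.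
- intros l u; eapply Rle_trans; [apply Cu_norm_scal|].
  rewrite Cmod_R; apply Rle_refl.
- intros u v e H; exact H.
- intros u v e H; rewrite Rmult_1_l; exact H.
- intros u H; apply Cu_ext; intros x; simpl.
  apply Cmod_eq_0, Rle_antisym; [|apply Cmod_ge_0].
  rewrite <- H; apply Cu_norm_ub.
Defined.
Canonical Cu_NormedModule :=
  NormedModule.Pack R_AbsRing Cu (NormedModule.Class _ _ _ Cu_NormedModule_mixin) Cu.

Lemma Cu_complete (F : (Cu -> Prop) -> Prop) :
  ProperFilter F -> cauchy F -> exists l : Cu, forall eps : posreal, F (ball l eps).
Proof.
intros FF FC.
set (G := filtermap Cu_fun F : ((R -> C) -> Prop) -> Prop).
assert (GF : ProperFilter G) by (apply filtermap_proper_filter; exact FF).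
assert (GC : @cauchy (fct_UniformSpace R C_UniformSpace) G).
{ intros eps; destruct (FC eps) as [u Hu].
  exists (Cu_fun u); unfold G, filtermap.
  revert Hu; apply filter_imp; intros v Hv x.
  apply C_NormedModule_mixin_compat1.
  eapply Rle_lt_trans; [|exact Hv].
  eapply Rle_trans; [|apply (Cu_norm_ub _ x)].
  apply Req_le; f_equal; simpl; unfold minus, plus, opp; simpl; ring. }
pose (CS := @fct_CompleteSpace R
  (CompleteNormedModule.CompleteSpace _ C_R_CompleteNormedModule)).
assert (HL := @complete_cauchy CS G GF GC).
set (l := @lim CS G : R -> C) in HL.
assert (Hl : forall eps : posreal, F (fun u : Cu => forall x, Cmod (u x - l x)%C < eps)).
{ intros eps.
  assert (He : 0 < eps / sqrt 2)
    by (apply Rdiv_lt_0_compat; [apply cond_pos | apply Rlt_sqrt2_0]).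
  specialize (HL (mkposreal _ He)).
  unfold G, filtermap in HL; revert HL; apply filter_imp; intros u Hu x.
  specialize (Hu x).
  apply (C_NormedModule_mixin_compat2 (l x) (u x) (mkposreal _ He)) in Hu.
  simpl in Hu.
  replace (sqrt 2 * (eps / sqrt 2)) with (pos eps) in Hu
    by (field; apply sqrt2_neq_0).
  exact Hu. }
assert (Hlu : is_Cu l).
{ split.
  - destruct (filter_ex _ (Hl (mkposreal 1 Rlt_0_1))) as [u Hu]; simpl in Hu.
    exists (Cu_norm u + 1); intros x.
    replace (l x) with (u x + - (u x - l x))%C by ring.
    eapply Rle_trans; [apply Cmod_triangle|]; rewrite Cmod_opp.
    apply Rplus_le_compat; [apply Cu_norm_ub | apply Rlt_le, Hu].
  - intros eps.
    assert (He : 0 < eps / 3) by (generalize (cond_pos eps); lra).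
    destruct (filter_ex _ (Hl (mkposreal _ He))) as [u Hu]; simpl in Hu.
    destruct (proj2 (Cu_is_Cu u) (mkposreal _ He)) as [d Hd]; simpl in Hd.
    exists d; intros x y Hxy; specialize (Hd x y Hxy).
    replace (l x - l y)%C
      with ((- (u x - l x) + (u x - u y)) + (u y - l y))%C by ring.
    eapply Rle_lt_trans; [apply Cmod_triangle|].
    eapply Rle_lt_trans; [apply Rplus_le_compat_r, Cmod_triangle|].
    rewrite Cmod_opp.
    assert (H1 := Hu x); assert (H2 := Hu y); lra. }
exists (mkCu l Hlu); intros eps.
generalize (Hl (pos_div_2 eps)); apply filter_imp; intros u Hu.
apply Rle_lt_trans with (eps / 2); [|generalize (cond_pos eps); lra].
apply Cu_norm_le; intros x; simpl.
replace (u x + -1 * l x)%C with (u x - l x)%C by ring.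
apply Rlt_le, (Hu x).
Qed.

Definition Cu_lim (F : (Cu -> Prop) -> Prop) : Cu :=
  epsilon (inhabits Cu_zero) (fun l => forall eps : posreal, F (ball l eps)).

Definition Cu_CompleteSpace_mixin : CompleteSpace.mixin_of Cu_UniformSpace.
Proof.
refine (CompleteSpace.Mixin Cu_UniformSpace Cu_lim _ _).
- intros F FF FC; unfold Cu_lim; apply epsilon_spec.
  exact (Cu_complete F FF FC).
- intros F1 F2 H12 H21.
  replace F2 with F1; [intros eps; apply ball_center|].
  apply functional_extensionality; intros P; apply propositional_extensionality.
  split; [apply H21 | apply H12].
Defined.
Canonical Cu_CompleteSpace :=
  CompleteSpace.Pack Cu (CompleteSpace.Class _ _ Cu_CompleteSpace_mixin) Cu.
Canonical Cu_CompleteNormedModule :=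
  CompleteNormedModule.Pack R_AbsRing Cu
    (CompleteNormedModule.Class R_AbsRing Cu
      (NormedModule.class _ Cu_NormedModule) Cu_CompleteSpace_mixin) Cu.

(** The sum runs over frequencies [j >= 1]: the value [a 0] is irrelevant. *)
Definition A_space (lambda : R) (u : Cu) : Prop :=
  exists a : nat -> C,
    ex_series (fun j => Cmod (a (S j))) /\
    forall x : R,
      @is_series C_AbsRing C_NormedModule
        (fun j => (a (S j) * Cexp (Ci * RtoC (x * INR (S j) * lambda)))%C) (u x).

(** Improper Riemann integral. For the kernels and functions used here the integrand is
    continuous and dominated by [K / (1 + y^2)], so it converges absolutely; see
    [dominated_is_RInt_gen] and [heat_kernel_bound]. *)
Definition convolution (G v : R -> C) (x : R) : C :=
  @RInt_gen C_R_CompleteNormedModule (fun y => (G y * v (x - y)%R)%C)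
    (Rbar_locally m_infty) (Rbar_locally p_infty).

Lemma is_lim_atan_p_infty : is_lim atan p_infty (PI / 2).
Proof.
apply is_lim_ext_loc with (fun x => PI / 2 - atan (/ x)).
{ exists 0; intros x Hx; rewrite atan_inv by assumption; ring. }
replace (Finite (PI / 2)) with (Finite (PI / 2 - 0)) by (f_equal; ring).
apply is_lim_minus'; [apply is_lim_const|].
rewrite <- atan_0.
apply is_lim_comp_continuous; [|apply continuous_atan].
replace (Finite 0) with (Rbar_inv p_infty) by reflexivity.
apply is_lim_inv; [apply is_lim_id | discriminate].
Qed.

Lemma is_lim_atan_m_infty : is_lim atan m_infty (- (PI / 2)).
Proof.
apply is_lim_ext with (fun x => - atan (- x)).
{ intros x; rewrite atan_opp; ring. }
change (Finite (- (PI / 2))) with (Rbar_opp (PI / 2)).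
apply is_lim_opp.
apply is_lim_comp with p_infty.
- apply is_lim_atan_p_infty.
- replace p_infty with (Rbar_opp m_infty) by reflexivity.
  apply is_lim_opp, is_lim_id.
- exists 0; intros; discriminate.
Qed.

Lemma is_RInt_cauchy_density (K a b : R) :
  is_RInt (fun y => K / (1 + y ^ 2)) a b (K * atan b - K * atan a).
Proof.
apply (is_RInt_derive (fun y => K * atan y) (fun y => K / (1 + y ^ 2))).
- intros y _; auto_derive; [trivial|]. unfold Rsqr; simpl; field; nra.
- intros y _; apply (@ex_derive_continuous R_AbsRing R_NormedModule).
  auto_derive; simpl; nra.
Qed.

Lemma filter_prod_infty_le :
  filter_prod (Rbar_locally m_infty) (Rbar_locally p_infty)
    (fun ab : R * R => fst ab <= snd ab).
Proof.
exists (fun x => x < 0) (fun x => 0 < x);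
  [exists 0; auto | exists 0; auto | simpl; intros; lra].
Qed.

Lemma is_RInt_gen_cauchy_density (K : R) :
  is_RInt_gen (fun y => K / (1 + y ^ 2))
    (Rbar_locally m_infty) (Rbar_locally p_infty) (K * PI).
Proof.
intros P HP.
assert (HL : filterlim (fun ab : R * R => K * atan (snd ab) - K * atan (fst ab))
  (filter_prod (Rbar_locally m_infty) (Rbar_locally p_infty)) (locally (K * PI))).
{ replace (K * PI) with (K * (PI / 2) - K * (- (PI / 2))) by field.
  unfold Rminus; eapply filterlim_comp_2;
    [| |apply (filterlim_plus (K * (PI / 2)) (- (K * - (PI / 2))))].
  - apply (filterlim_comp _ _ _ snd (fun y => K * atan y) _ (Rbar_locally p_infty));
      [apply filterlim_snd|].
    exact (is_lim_scal_l atan K p_infty _ is_lim_atan_p_infty).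
  - apply (filterlim_comp _ _ _ fst (fun y => - (K * atan y)) _ (Rbar_locally m_infty));
      [apply filterlim_fst|].
    exact (is_lim_opp _ m_infty _
      (is_lim_scal_l atan K m_infty _ is_lim_atan_m_infty)). }
generalize (HL P HP); unfold filtermapi, filtermap; apply filter_imp.
intros [a b] H; eexists; split; [apply is_RInt_cauchy_density | exact H].
Qed.

Lemma dominated_RInt_bound (f : R -> C) (K a b : R) :
  (forall y, @continuous R_UniformSpace C_R_CompleteNormedModule f y) ->
  (forall y, Cmod (f y) <= K / (1 + y ^ 2)) ->
  Cmod (@RInt C_R_CompleteNormedModule f a b) <= Rabs (K * atan b - K * atan a).
Proof.
intros hf hK.
assert (Hle : forall c d, c <= d ->
  Cmod (@RInt C_R_CompleteNormedModule f c d) <= K * atan d - K * atan c).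
{ intros c d Hcd; rewrite Cmod_norm.
  apply (norm_RInt_le f (fun y => K / (1 + y ^ 2)) c d); try assumption.
  - intros y _; rewrite <- Cmod_norm; apply hK.
  - apply (@RInt_correct C_R_CompleteNormedModule), ex_RInt_continuous; auto.
  - apply is_RInt_cauchy_density. }
destruct (Rle_dec a b) as [H | H].
- eapply Rle_trans; [apply Hle, H | apply Rle_abs].
- rewrite <- (@opp_RInt_swap C_R_CompleteNormedModule)
    by (apply ex_RInt_continuous; auto).
  change (Cmod (- @RInt C_R_CompleteNormedModule f b a)%C
    <= Rabs (K * atan b - K * atan a)).
  rewrite Cmod_opp, Rabs_minus_sym.
  eapply Rle_trans; [apply Hle; lra | apply Rle_abs].
Qed.

Lemma dominated_ex_RInt_gen (f : R -> C) (K : R) :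
  (forall y, @continuous R_UniformSpace C_R_CompleteNormedModule f y) ->
  (forall y, Cmod (f y) <= K / (1 + y ^ 2)) ->
  @ex_RInt_gen C_R_NormedModule f (Rbar_locally m_infty) (Rbar_locally p_infty).
Proof.
intros hf hK.
pose (V := C_R_CompleteNormedModule).
pose (F := filter_prod (Rbar_locally m_infty) (Rbar_locally p_infty)).
assert (FF : ProperFilter F) by (apply filter_prod_proper).
assert (Hex : forall c d, @ex_RInt V f c d)
  by (intros; apply ex_RInt_continuous; auto).
destruct (proj1 (@filterlim_locally_cauchy _ (CompleteNormedModule.CompleteSpace _ V)
  F FF (fun ab : R * R => @RInt V f (fst ab) (snd ab)))) as [l Hl].
{ intros eps.
  assert (He : 0 < eps / 4) by (generalize (cond_pos eps); lra).
  assert (Lp : is_lim (fun y => K * atan y) p_infty (K * (PI / 2)))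
    by exact (is_lim_scal_l atan K p_infty _ is_lim_atan_p_infty).
  assert (Lm : is_lim (fun y => K * atan y) m_infty (K * (- (PI / 2))))
    by exact (is_lim_scal_l atan K m_infty _ is_lim_atan_m_infty).
  apply is_lim_spec in Lp; apply is_lim_spec in Lm.
  specialize (Lp (mkposreal _ He)); specialize (Lm (mkposreal _ He)).
  simpl in Lp, Lm.
  exists (fun ab : R * R => Rabs (K * atan (fst ab) - K * (- (PI / 2))) < eps / 4 /\
    Rabs (K * atan (snd ab) - K * (PI / 2)) < eps / 4); split.
  { eexists; [exact Lm | exact Lp | simpl; auto]. }
  intros [a b] [a' b'] [H1 H2] [H3 H4]; simpl in *.
  apply C_NormedModule_mixin_compat1.
  assert (E : minus (@RInt V f a' b') (@RInt V f a b)
    = (@RInt V f a' a + @RInt V f b b')%C).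
  { rewrite <- (@RInt_Chasles V f a' a b') by auto.
    rewrite <- (@RInt_Chasles V f a b b') by auto.
    generalize (@RInt V f a' a) (@RInt V f a b) (@RInt V f b b'); intros p q r.
    change ((p + (q + r) + - q)%C = (p + r)%C); ring. }
  eapply Rle_lt_trans; [apply Req_le, f_equal, E|].
  eapply Rle_lt_trans; [apply Cmod_triangle|].
  assert (B1 := dominated_RInt_bound f K a' a hf hK); assert (B2 := dominated_RInt_bound f K b b' hf hK).
  fold V in B1, B2.
  apply Rabs_def2 in H1; apply Rabs_def2 in H2;
    apply Rabs_def2 in H3; apply Rabs_def2 in H4.
  assert (Rabs (K * atan a - K * atan a') < eps / 2) by (apply Rabs_def1; lra).
  assert (Rabs (K * atan b' - K * atan b) < eps / 2) by (apply Rabs_def1; lra).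
  lra. }
exists l; intros P HP; generalize (Hl P HP).
unfold filtermapi, filtermap; apply filter_imp; intros [a b] H.
eexists; split; [apply (@RInt_correct V), Hex | exact H].
Qed.

Lemma dominated_is_RInt_gen (f : R -> C) (K : R) :
  (forall y, @continuous R_UniformSpace C_R_CompleteNormedModule f y) ->
  (forall y, Cmod (f y) <= K / (1 + y ^ 2)) ->
  @is_RInt_gen C_R_NormedModule f (Rbar_locally m_infty) (Rbar_locally p_infty)
    (@RInt_gen C_R_CompleteNormedModule f
      (Rbar_locally m_infty) (Rbar_locally p_infty)).
Proof.
intros hf hK.
apply (@RInt_gen_correct C_R_CompleteNormedModule);
  try (apply Proper_StrongProper, Rbar_locally_filter).
exact (dominated_ex_RInt_gen f K hf hK).
Qed.

Lemma dominated_is_RInt_gen_bound (f : R -> C) (K : R) (l : C) :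
  (forall y, Cmod (f y) <= K / (1 + y ^ 2)) ->
  @is_RInt_gen C_R_NormedModule f (Rbar_locally m_infty) (Rbar_locally p_infty) l ->
  Cmod l <= K * PI.
Proof.
intros hK H; rewrite Cmod_norm.
apply (@RInt_gen_norm C_R_CompleteNormedModule (Rbar_locally m_infty)
  (Rbar_locally p_infty) _ _ f (fun y => K / (1 + y ^ 2)) l (K * PI)).
- apply filter_prod_infty_le.
- exists (fun _ => True) (fun _ => True); [exists 0; auto | exists 0; auto |].
  intros a b _ _ y _; rewrite <- Cmod_norm; apply hK.
- exact H.
- apply is_RInt_gen_cauchy_density.
Qed.

Lemma continuous_Cmult (f g : R -> C) (y : R) :
  @continuous R_UniformSpace C_R_CompleteNormedModule f y ->
  @continuous R_UniformSpace C_R_CompleteNormedModule g y ->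
  @continuous R_UniformSpace C_R_CompleteNormedModule (fun z => (f z * g z)%C) y.
Proof.
intros Hf Hg.
assert (H : forall (h : R -> C), (forall P : C -> Prop, @locally C_UniformSpace (h y) P ->
  filtermap h (locally y) P) <->
  (forall P : C -> Prop, @locally (AbsRing_UniformSpace C_AbsRing) (h y) P ->
  filtermap h (locally y) P)).
{ intros h; split; intros Hh P HP; apply Hh, locally_C, HP. }
exact (proj2 (H (fun z => (f z * g z)%C))
  (@continuous_mult R_UniformSpace C_AbsRing f g y
    (proj1 (H f) Hf) (proj1 (H g) Hg))).
Qed.

Lemma Cu_continuous (v : Cu) (y : R) :
  @continuous R_UniformSpace C_R_CompleteNormedModule v y.
Proof.
apply (filterlim_locally (U := C_UniformSpace)); intros eps.
destruct (proj2 (Cu_is_Cu v) eps) as [d Hd].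
exists d; intros z Hz.
apply C_NormedModule_mixin_compat1.
exact (Hd z y Hz).
Qed.

Lemma is_Cu_convolution (G : R -> C) (K : R) (v : Cu) :
  (forall y, @continuous R_UniformSpace C_R_CompleteNormedModule G y) ->
  (forall y, Cmod (G y) <= K / (1 + y ^ 2)) ->
  is_Cu (convolution G v).
Proof.
intros hG hK.
assert (HK0 : 0 <= K).
{ generalize (hK 0) (Cmod_ge_0 (G 0)); simpl.
  replace (K / (1 + 0 * (0 * 1))) with K by field; lra. }
assert (Hcont : forall x y, @continuous R_UniformSpace C_R_CompleteNormedModule
  (fun y => (G y * v (x - y)%R)%C) y).
{ intros x y; apply continuous_Cmult; [apply hG|].
  apply (continuous_comp (fun y => x - y) v); [|apply Cu_continuous].
  apply (@ex_derive_continuous R_AbsRing R_NormedModule); auto_derive; trivial. }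
assert (Hinv : forall y : R, 0 < / (1 + y ^ 2))
  by (intros y; apply Rinv_0_lt_compat; simpl; nra).
assert (Hbd : forall x y, Cmod (G y * v (x - y)%R)%C <= (K * Cu_norm v) / (1 + y ^ 2)).
{ intros x y; rewrite Cmod_mult.
  replace (K * Cu_norm v / (1 + y ^ 2)) with (K / (1 + y ^ 2) * Cu_norm v)
    by (unfold Rdiv; ring).
  apply Rmult_le_compat; auto using Cmod_ge_0, Cu_norm_ub. }
assert (Hint := fun x => dominated_is_RInt_gen _ _ (Hcont x) (Hbd x)).
split.
- exists (K * Cu_norm v * PI); intros x.
  exact (dominated_is_RInt_gen_bound _ _ _ (Hbd x) (Hint x)).
- intros eps.
  assert (HPI := PI_RGT_0).
  assert (Hp : 0 < K * PI + 1) by nra.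
  assert (He : 0 < eps / (K * PI + 1))
    by (apply Rdiv_lt_0_compat; [apply cond_pos | exact Hp]).
  set (e := eps / (K * PI + 1)) in He.
  destruct (proj2 (Cu_is_Cu v) (mkposreal _ He)) as [d Hd]; simpl in Hd.
  exists d; intros x x' Hx.
  apply Rle_lt_trans with (K * e * PI).
  + apply (dominated_is_RInt_gen_bound
      (fun y => (G y * v (x - y)%R - G y * v (x' - y)%R)%C)).
    * intros y.
      replace (G y * v (x - y)%R - G y * v (x' - y)%R)%C
        with (G y * (v (x - y)%R - v (x' - y)%R))%C by ring.
      rewrite Cmod_mult.
      replace (K * e / (1 + y ^ 2)) with (K / (1 + y ^ 2) * e)
        by (unfold Rdiv; ring).
      apply Rmult_le_compat; auto using Cmod_ge_0.
      apply Rlt_le, Hd.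
      replace (x - y - (x' - y)) with (x - x') by ring; exact Hx.
    * exact (@is_RInt_gen_minus C_R_NormedModule _ _ _ _ _ _ _ _ (Hint x) (Hint x')).
  + assert (eps = e * (K * PI + 1) :> R) by (unfold e; field; lra).
    rewrite H; nra.
Qed.

Definition heat_kernel (alpha beta gamma t x : R) : C :=
  (/ Csqrt (RtoC (4 * PI * t) * (alpha, beta)) *
   Cexp (- (RtoC (x ^ 2) / (RtoC (4 * t) * (alpha, beta))) + RtoC (gamma * t)))%C.

Lemma heat_kernel_exponent (alpha beta gamma t x : R) : 0 < alpha -> 0 < t ->
  (- (RtoC (x ^ 2) / (RtoC (4 * t) * (alpha, beta))) + RtoC (gamma * t))%C =
  (- (alpha * x ^ 2 / (4 * t * (alpha ^ 2 + beta ^ 2))) + gamma * t,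
   beta * x ^ 2 / (4 * t * (alpha ^ 2 + beta ^ 2))).
Proof.
intros Ha Ht.
assert (0 < alpha ^ 2 + beta ^ 2) by nra.
unfold Cdiv, Cinv, Cmult, Cplus, Copp, RtoC; simpl.
assert (0 < t * t) by nra.
assert (0 < (alpha ^ 2 + beta ^ 2) * (t * t)) by nra.
f_equal; field; repeat split; nra.
Qed.

Lemma heat_kernel_continuous (alpha beta gamma t x : R) : 0 < alpha -> 0 < t ->
  @continuous R_UniformSpace C_R_CompleteNormedModule
    (heat_kernel alpha beta gamma t) x.
Proof.
intros Ha Ht.
assert (Hab : 0 < alpha ^ 2 + beta ^ 2) by nra.
apply continuous_Cmult; [apply continuous_const|].
apply (continuous_ext (T := R_UniformSpace) (U := C_UniformSpace) (fun y =>
  Cexp (- (alpha * y ^ 2 / (4 * t * (alpha ^ 2 + beta ^ 2))) + gamma * t,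
   beta * y ^ 2 / (4 * t * (alpha ^ 2 + beta ^ 2))))).
{ intros y; rewrite heat_kernel_exponent by assumption; reflexivity. }
unfold Cexp; cbn [fst snd].
apply (continuous_comp_2 (V := R_UniformSpace) (W := R_UniformSpace)
  (X := C_UniformSpace) _ _ (fun p q => (p, q)));
  try (apply (@ex_derive_continuous R_AbsRing R_NormedModule); auto_derive;
       repeat split; nra).
apply (continuous_ext (fun z : C_UniformSpace => z)); [intros []; reflexivity|].
apply continuous_id.
Qed.

Lemma heat_kernel_bound (alpha beta gamma t : R) : 0 < alpha -> 0 < t ->
  exists K : R, forall x, Cmod (heat_kernel alpha beta gamma t x) <= K / (1 + x ^ 2).
Proof.
intros Ha Ht.
assert (Hab : 0 < alpha ^ 2 + beta ^ 2) by nra.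
set (c := alpha / (4 * t * (alpha ^ 2 + beta ^ 2))).
assert (Hc : 0 < c) by (apply Rdiv_lt_0_compat; nra).
set (k := Cmod (/ Csqrt (RtoC (4 * PI * t) * (alpha, beta)))%C * exp (gamma * t)).
assert (Hk : 0 <= k)
  by (apply Rmult_le_pos; [apply Cmod_ge_0 | apply Rlt_le, exp_pos]).
exists (k * (1 + / c)); intros x.
unfold heat_kernel; rewrite Cmod_mult, Cmod_Cexp, heat_kernel_exponent by assumption.
cbn [fst].
replace (alpha * x ^ 2 / (4 * t * (alpha ^ 2 + beta ^ 2))) with (c * x ^ 2)
  by (unfold c; field; nra).
rewrite exp_plus, exp_Ropp.
replace (k * (1 + / c) / (1 + x ^ 2)) with (k * ((1 + / c) / (1 + x ^ 2)))
  by (unfold Rdiv; ring).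
rewrite (Rmult_comm (/ exp _)), <- Rmult_assoc; fold k.
apply Rmult_le_compat_l; [exact Hk|].
assert (Hx : 0 <= x ^ 2) by nra.
assert (Hcx0 : 0 <= c * x ^ 2) by (apply Rmult_le_pos; lra).
assert (Hcx : 1 + c * x ^ 2 <= exp (c * x ^ 2)) by apply exp_ineq1_le.
apply Rle_trans with (/ (1 + c * x ^ 2)).
- apply Rinv_le_contravar; lra.
- assert (Hci : c * / c = 1) by (apply Rinv_r; lra).
  assert (0 < / c) by (apply Rinv_0_lt_compat; exact Hc).
  apply Rmult_le_reg_r with ((1 + c * x ^ 2) * (1 + x ^ 2)); [nra|].
  replace (/ (1 + c * x ^ 2) * ((1 + c * x ^ 2) * (1 + x ^ 2))) with (1 + x ^ 2)
    by (field; nra).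
  replace ((1 + / c) / (1 + x ^ 2) * ((1 + c * x ^ 2) * (1 + x ^ 2)))
    with ((1 + / c) * (1 + c * x ^ 2)) by (field; split; nra).
  replace ((1 + / c) * (1 + c * x ^ 2))
    with (1 + / c + c * x ^ 2 + c * / c * x ^ 2) by ring.
  rewrite Hci; nra.
Qed.

Lemma is_Cu_heat (alpha beta gamma t : R) (v : Cu) : 0 < alpha -> 0 < t ->
  is_Cu (convolution (heat_kernel alpha beta gamma t) v).
Proof.
intros Ha Ht.
destruct (heat_kernel_bound alpha beta gamma t Ha Ht) as [K hK].
apply (is_Cu_convolution _ K); [|exact hK].
intros y; apply heat_kernel_continuous; assumption.
Qed.

(** Only meaningful for [0 < alpha] and [0 <= t]; the value [v] at [t = 0] is the
    identity, elsewhere (negative times, non-parabolic [alpha]) it is a dummy. *)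
Definition semigroup (alpha beta gamma t : R) (v : Cu) : Cu :=
  match Rlt_dec 0 alpha, Rlt_dec 0 t with
  | left Ha, left Ht =>
      mkCu (convolution (heat_kernel alpha beta gamma t) v)
        (is_Cu_heat alpha beta gamma t v Ha Ht)
  | _, _ => v
  end.

Lemma semigroup_0 (alpha beta gamma : R) (v : Cu) : semigroup alpha beta gamma 0 v = v.
Proof.
unfold semigroup; destruct (Rlt_dec 0 alpha); [|reflexivity].
destruct (Rlt_dec 0 0) as [H|]; [elim (Rlt_irrefl 0 H) | reflexivity].
Qed.

Lemma semigroup_pos (alpha beta gamma t : R) (v : Cu) (x : R) :
  0 < alpha -> 0 < t ->
  semigroup alpha beta gamma t v x = convolution (heat_kernel alpha beta gamma t) v x.
Proof.
intros Ha Ht; unfold semigroup.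
destruct (Rlt_dec 0 alpha); [|contradiction].
destruct (Rlt_dec 0 t); [reflexivity | contradiction].
Qed.

(** A mild solution of [u' = A u + c B(u)], [u(0) = u0], where [A] generates [U].
    Time-dependent functions are total on [R], but only their values on the interval
    are constrained. [RInt] is the [Cu]-valued Riemann integral; it is total, hence
    the explicit [ex_RInt]. *)
Definition mild_solution (U : R -> Cu -> Cu) (c : C) (B : Cu -> Cu) (u0 : Cu)
    (T : R) (u : R -> Cu) : Prop :=
  continuous_on (fun t => 0 <= t <= T) u /\
  forall t, 0 <= t <= T ->
    ex_RInt (fun s => U (t - s) (B (u s))) 0 t /\
    u t = plus (U t u0) (Cu_scal c (RInt (fun s => U (t - s) (B (u s))) 0 t)).

Definition mild_solution_below (U : R -> Cu -> Cu) (c : C) (B : Cu -> Cu) (u0 : Cu)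
    (Tstar : Rbar) (u : R -> Cu) : Prop :=
  forall T : R, Rbar_lt T Tstar -> mild_solution U c B u0 T u.

(** Maximality: no mild solution on a strictly longer interval extends [u]. *)
Definition maximal_mild_solution (U : R -> Cu -> Cu) (c : C) (B : Cu -> Cu) (u0 : Cu)
    (Tstar : Rbar) (u : R -> Cu) : Prop :=
  Rbar_lt 0 Tstar /\
  mild_solution_below U c B u0 Tstar u /\
  forall (T' : Rbar) (v : R -> Cu),
    Rbar_lt Tstar T' -> mild_solution_below U c B u0 T' v ->
    ~ (forall t : R, 0 <= t -> Rbar_lt t Tstar -> v t = u t).

Definition neg_pow (n : nat) (u : Cu) : Cu := Cu_opp (Cu_pow u n).

(* Main.v *)
Require Import Defs.
From Stdlib Require Import Reals Arith Lra Lia.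
From Coquelicot Require Import Coquelicot.
Open Scope R_scope.

(** Let [X] be the closure in [Cu] of the span of the modes [e_j(x) = e^{i (j+1) lambda x}].
    Membership of [u(t)] in [A_space] is obtained in two steps.

    First, [u(t)] stays in [X].  Since [e_j e_k = e_{j+k+1}], [X] is closed under products, and
    the semigroup maps each mode to a multiple of itself.  Hence the distance [d(s)] of [u(s)]
    to [X] satisfies [d(t) <= C int_0^t d(s) ds] as long as [u] is bounded, because [u^n] is
    locally Lipschitz and the initial value lies in [X] ([A_space_near]); so [d = 0] by Gronwall
    ([mild_solution_near]).

    Second, the semigroup smooths, and this makes the Fourier coefficients of [u(t)] summable.
    For [lambda <> 0] the [j]-th Fourier coefficient of [U(t) v], [v] in [X], is that of [v]
    times a factor [O((1 + k^2 t)^{-2})] with [k = (j+1) lambda] ([fourier_semigroup]).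
    Integrating this factor over [0, t] in Duhamel's formula gives a bound [O(1/k^2)] that only
    involves the sup norm of [u] ([mild_solution_fourier_decay]).  An element of [X] whose
    Fourier coefficients are summable is the sum of its Fourier series, because an element of
    [X] with vanishing coefficients has vanishing [L^2] norm over each period
    ([fourier_injective], [near_summable_A_space]).  For [lambda = 0] the space [X] consists of
    constants ([near_0_A_space]).

    The decay of the multipliers comes from smoothness of the Gaussian rather than from a
    formula for its Fourier transform: after the substitution [y = sqrt t w] in the convolution
    the multiplier is the Fourier transform at [sqrt t k] of one fixed Gaussian, and repeated
    integration by parts bounds it by every negative power of the frequency
    ([gauss_moment_recurrence], [gauss_moment_decay]). *)

(** * Integrals with values in closed convex cones *)

Lemma SF_h_le_last (ptd : SF_seq) :
  pointed_subdiv ptd -> SF_h ptd <= seq.last (SF_h ptd) (SF_lx ptd).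
Proof.
apply SF_cons_ind with (s := ptd); clear ptd.
- intros x0 _; simpl; apply Rle_refl.
- intros h s IH Hs.
  assert (H0 := Hs 0%nat).
  rewrite SF_size_cons in H0; specialize (H0 ltac:(lia)); simpl in H0.
  specialize (IH (ptd_cons _ _ Hs)).
  simpl in *; unfold SF_lx, SF_h in *; simpl in *; lra.
Qed.

(** Each Riemann sum of [f] is a conical combination of values of [f]. *)
Lemma closed_cone_RInt {V : NormedModule R_AbsRing} (K : V -> Prop)
    (f : R -> V) (a b : R) (I : V) :
  a <= b -> K zero ->
  (forall x y, K x -> K y -> K (plus x y)) ->
  (forall r x, 0 <= r -> K x -> K (scal r x)) ->
  (forall x, (forall eps : posreal, exists y, K y /\ ball x eps y) -> K x) ->
  (forall s, a <= s <= b -> K (f s)) ->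
  is_RInt f a b I -> K I.
Proof.
intros Hab K0 Kp Ks Kc Kf HI.
assert (Hsum : forall ptd : SF_seq, pointed_subdiv ptd ->
  (forall s, SF_h ptd <= s <= seq.last (SF_h ptd) (SF_lx ptd) -> K (f s)) ->
  K (Riemann_sum f ptd)).
{ intros ptd; apply SF_cons_ind with (s := ptd); clear ptd.
  - intros x0 _ _; exact K0.
  - intros h s IH Hs Hf.
    assert (H0 := Hs 0%nat).
    rewrite SF_size_cons in H0; specialize (H0 ltac:(lia)).
    assert (Hl := SF_h_le_last _ (ptd_cons _ _ Hs)).
    rewrite Riemann_sum_cons.
    simpl in *; unfold SF_lx, SF_h in *; simpl in *.
    apply Kp.
    + apply Ks; [lra|]. apply Hf; lra.
    + apply IH; [exact (ptd_cons _ _ Hs)|].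
      intros t Ht; apply Hf; lra. }
apply Kc; intros eps.
destruct (Riemann_fine_filter a b) as [Hex HF].
assert (H1 := HI (ball I eps) (locally_ball I eps)).
assert (H2 : Riemann_fine a b (fun ptd : SF_seq => pointed_subdiv ptd /\
   SF_h ptd = Rmin a b /\ seq.last (SF_h ptd) (SF_lx ptd) = Rmax a b)).
{ exists (mkposreal 1 Rlt_0_1); intros ptd _ H; exact H. }
destruct (Hex _ (@filter_and _ _ HF _ _ H1 H2)) as [ptd [Hb [Hp [Hh Hl]]]].
eexists; split; [|exact Hb].
apply Ks.
- destruct (Rle_lt_or_eq_dec 0 (b - a)) as [H|H]; [lra| |].
  + rewrite sign_eq_1; lra.
  + rewrite <- H, sign_0; lra.
- apply Hsum; [exact Hp|].
  rewrite Hl, Hh, Rmin_left, Rmax_right by exact Hab; exact Kf.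
Qed.

(** An integral version of [norm_RInt_le] for the relation [q r v], to be read as: a given
    seminorm of [v] is at most [r].  The pairs related by [q] form a closed convex cone in the
    product space [R * V], which contains the integral of [(g, f)]. *)
Lemma closed_cone_RInt_majorant {V : NormedModule R_AbsRing}
    (q : R -> V -> Prop) (g : R -> R) (f : R -> V) (a b J : R) (I : V) :
  a <= b -> q 0 zero ->
  (forall r1 v1 r2 v2, q r1 v1 -> q r2 v2 -> q (r1 + r2) (plus v1 v2)) ->
  (forall l r v, 0 <= l -> q r v -> q (l * r) (scal l v)) ->
  (forall r v, (forall eps : posreal, exists r' v',
     q r' v' /\ Rabs (r' - r) < eps /\ norm (minus v' v) < eps) -> q r v) ->
  (forall s, a <= s <= b -> q (g s) (f s)) ->
  is_RInt g a b J -> is_RInt f a b I -> q J I.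
Proof.
intros Hab q0 qp qs qc qf HJ HI.
apply (closed_cone_RInt (V := prod_NormedModule R_AbsRing R_NormedModule V)
  (fun p => q (fst p) (snd p)) (fun s => (g s, f s)) a b (J, I)); auto.
- intros [r1 v1] [r2 v2] H1 H2; simpl; apply qp; assumption.
- intros l [r v] Hl H; simpl; apply qs; assumption.
- intros [r v] H; apply qc; intros eps.
  assert (Hn := @norm_factor_gt_0 _ V).
  assert (He : 0 < Rmin eps (eps / norm_factor (V := V))).
  { apply Rmin_glb_lt; [apply cond_pos|].
    apply Rdiv_lt_0_compat; [apply cond_pos | exact Hn]. }
  destruct (H (mkposreal _ He)) as [[r' v'] [Hq [Hb1 Hb2]]]; simpl in *.
  exists r', v'; split; [exact Hq|split].
  + apply Rlt_le_trans with (2 := Rmin_l eps (eps / norm_factor (V := V))).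
    exact Hb1.
  + assert (Hb := norm_compat2 v v' (mkposreal _ He) Hb2); simpl in Hb.
    eapply Rlt_le_trans; [exact Hb|].
    apply Rle_trans with (norm_factor (V := V) * (eps / norm_factor (V := V))).
    * apply Rmult_le_compat_l; [lra | apply Rmin_r].
    * apply Req_le; field; lra.
- apply is_RInt_fct_extend_pair; simpl; assumption.
Qed.

(** * Complex-valued integrals *)

Notation is_CInt := (@is_RInt C_R_NormedModule).
Notation is_CInt_R f := (@is_RInt_gen C_R_NormedModule f
  (Rbar_locally m_infty) (Rbar_locally p_infty)).

Lemma is_CInt_pair (f : R -> C) (a b : R) (l : C) :
  is_RInt (fun x => fst (f x)) a b (fst l) ->
  is_RInt (fun x => snd (f x)) a b (snd l) -> is_CInt f a b l.
Proof.
intros H1 H2; destruct l as [l1 l2].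
exact (is_RInt_fct_extend_pair (U := R_NormedModule) (V := R_NormedModule)
  f a b l1 l2 H1 H2).
Qed.

Lemma is_CInt_fst (f : R -> C) (a b : R) (l : C) :
  is_CInt f a b l -> is_RInt (fun x => fst (f x)) a b (fst l).
Proof.
exact (is_RInt_fct_extend_fst (U := R_NormedModule) (V := R_NormedModule) f a b l).
Qed.

Lemma is_CInt_snd (f : R -> C) (a b : R) (l : C) :
  is_CInt f a b l -> is_RInt (fun x => snd (f x)) a b (snd l).
Proof.
exact (is_RInt_fct_extend_snd (U := R_NormedModule) (V := R_NormedModule) f a b l).
Qed.

Lemma is_CInt_Cmult (c : C) (f : R -> C) (a b : R) (l : C) :
  is_CInt f a b l -> is_CInt (fun x => (c * f x)%C) a b (c * l)%C.
Proof.
intros H; assert (H1 := is_CInt_fst _ _ _ _ H); assert (H2 := is_CInt_snd _ _ _ _ H).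
destruct c as [c1 c2]; apply is_CInt_pair; simpl.
- exact (is_RInt_minus _ _ _ _ _ _ (is_RInt_scal _ _ _ c1 _ H1)
    (is_RInt_scal _ _ _ c2 _ H2)).
- exact (is_RInt_plus _ _ _ _ _ _ (is_RInt_scal _ _ _ c1 _ H2)
    (is_RInt_scal _ _ _ c2 _ H1)).
Qed.

Lemma locally_C_Cmod (l : C) (P : C -> Prop) :
  @locally C_UniformSpace l P <->
  exists eps : posreal, forall z, Cmod (z - l) < eps -> P z.
Proof.
split.
- intros [e He]; exists e; intros z Hz; apply He.
  apply C_NormedModule_mixin_compat1; exact Hz.
- intros [e He].
  assert (Hd : 0 < e / sqrt 2)
    by (apply Rdiv_lt_0_compat; [apply cond_pos | apply Rlt_sqrt2_0]).
  exists (mkposreal _ Hd); intros z Hz; apply He.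
  apply (C_NormedModule_mixin_compat2 l z (mkposreal _ Hd)) in Hz; simpl in Hz.
  replace (sqrt 2 * (e / sqrt 2)) with (pos e) in Hz
    by (field; apply sqrt2_neq_0).
  exact Hz.
Qed.

Lemma is_CInt_R_Cmult (c : C) (f : R -> C) (l : C) :
  is_CInt_R f l -> is_CInt_R (fun x => (c * f x)%C) (c * l)%C.
Proof.
intros H P HP; apply locally_C_Cmod in HP; destruct HP as [e He].
assert (Hc := Cmod_ge_0 c).
assert (Hd : 0 < e / (Cmod c + 1))
  by (apply Rdiv_lt_0_compat; [apply cond_pos | lra]).
assert (HQ : @locally C_UniformSpace l (fun z => Cmod (z - l) < e / (Cmod c + 1)))
  by (apply locally_C_Cmod; exists (mkposreal _ Hd); auto).
generalize (H _ HQ); unfold filtermapi; apply filter_imp; intros [a b] [z [Hz Hlz]].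
exists (c * z)%C; split; [apply is_CInt_Cmult, Hz|].
apply He; replace (c * z - c * l)%C with (c * (z - l))%C by ring.
rewrite Cmod_mult.
apply Rle_lt_trans with (Cmod c * (e / (Cmod c + 1))).
- apply Rmult_le_compat_l; lra.
- assert (pos e = e / (Cmod c + 1) * (Cmod c + 1)) by (field; lra).
  set (d := e / (Cmod c + 1)) in *; rewrite H0; lra.
Qed.

Lemma is_CInt_R_ext (f g : R -> C) (l : C) :
  (forall x, f x = g x) -> is_CInt_R f l -> is_CInt_R g l.
Proof.
intros Hfg; apply is_RInt_gen_ext.
exists (fun _ => True) (fun _ => True); [exists 0; auto | exists 0; auto |].
intros; apply Hfg.
Qed.

Lemma is_CInt_R_unique (f : R -> C) (l l' : C) :
  is_CInt_R f l -> is_CInt_R f l' -> l = l'.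
Proof.
intros H H'.
rewrite <- (@is_RInt_gen_unique C_R_CompleteNormedModule _ _ _ _ f l H).
apply (@is_RInt_gen_unique C_R_CompleteNormedModule _ _ _ _ f l' H').
Qed.

Lemma is_CInt_R_plus (f g : R -> C) (l m : C) :
  is_CInt_R f l -> is_CInt_R g m -> is_CInt_R (fun x => (f x + g x)%C) (l + m)%C.
Proof. intros H1 H2; exact (is_RInt_gen_plus (V := C_R_NormedModule) f g l m H1 H2). Qed.

Lemma is_CInt_R_rescale (r : R) (f : R -> C) (l : C) : 0 < r ->
  is_CInt_R f l -> is_CInt_R (fun w => (RtoC r * f (r * w)%R)%C) l.
Proof.
intros Hr H P HP.
destruct (H P HP) as [Q1 Q2 [M1 HM1] [M2 HM2] HQ].
exists (fun x => x < M1 / r) (fun x => M2 / r < x);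
  [exists (M1 / r); auto | exists (M2 / r); auto |].
intros a b Ha Hb.
destruct (HQ (r * a) (r * b)) as [z [Hz HPz]].
- apply HM1; apply Rlt_div_r in Ha; lra.
- apply HM2; apply Rlt_div_l in Hb; lra.
- exists z; split; [|exact HPz]; simpl in *.
  replace (r * a) with (r * a + 0) in Hz by ring.
  replace (r * b) with (r * b + 0) in Hz by ring.
  generalize (is_RInt_comp_lin f r 0 a b z Hz); apply is_RInt_ext.
  intros x _; rewrite Rplus_0_r.
  rewrite scal_R_Cmult; reflexivity.
Qed.


(** * Moments of a complex Gaussian *)

Lemma pow_le_exp (N : nat) : forall c : R, 0 < c ->
  exists B : R, forall y, 0 <= y -> (1 + y) ^ N <= B * exp (c * y).
Proof.
induction N as [|N IH]; intros c Hc.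
- exists 1; intros y Hy; simpl.
  generalize (exp_ineq1_le (c * y)); nra.
- destruct (IH (c / 2)) as [B HB]; [lra|].
  exists ((1 + / (c / 2)) * B); intros y Hy.
  assert (Hi : 0 < / (c / 2)) by (apply Rinv_0_lt_compat; lra).
  assert (H1 : 1 + y <= (1 + / (c / 2)) * exp (c / 2 * y)).
  { assert (H := exp_ineq1_le (c / 2 * y)).
    apply Rle_trans with ((1 + / (c / 2)) * (1 + c / 2 * y)).
    - assert (c / 2 * / (c / 2) = 1) by (field; lra). nra.
    - apply Rmult_le_compat_l; lra. }
  replace (c * y) with (c / 2 * y + c / 2 * y) by field.
  rewrite exp_plus; simpl.
  replace ((1 + / (c / 2)) * B * (exp (c / 2 * y) * exp (c / 2 * y)))
    with ((1 + / (c / 2)) * exp (c / 2 * y) * (B * exp (c / 2 * y))) by ring.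
  apply Rmult_le_compat; [lra | apply pow_le; lra | exact H1 | apply HB, Hy].
Qed.

(** For [xi = 0], [m = 0] and suitable [c], [d] this is the heat kernel at unit time up to a
    constant factor; the factor [exp (- i xi w)] gives its Fourier transform, and the powers [w ^ m] are what integration by parts produces. *)
Definition gauss_mode (c d xi : R) (m : nat) (w : R) : C :=
  (RtoC (w ^ m) * Cexp (- (c * w ^ 2), d * w ^ 2 - xi * w)%R)%C.

Lemma gauss_mode_bound (c d : R) (m : nat) : 0 < c ->
  exists B, forall xi w, Cmod (gauss_mode c d xi m w) <= B / (1 + w ^ 2).
Proof.
intros Hc; destruct (pow_le_exp (S m) c Hc) as [B HB].
exists B; intros xi w; unfold gauss_mode.
rewrite Cmod_mult, Cmod_R, Cmod_Cexp; cbn [fst]; rewrite exp_Ropp.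
assert (Hw : 0 <= w ^ 2) by nra.
assert (H := HB (w ^ 2) Hw).
assert (He := exp_pos (c * w ^ 2)).
apply (Rle_div_r _ _ (1 + w ^ 2)); [lra|].
apply Rmult_le_reg_r with (exp (c * w ^ 2)); [exact He|].
replace (Rabs (w ^ m) * / exp (c * w ^ 2) * (1 + w ^ 2) * exp (c * w ^ 2))
  with ((1 + w ^ 2) * Rabs (w ^ m)) by (field; lra).
eapply Rle_trans; [|exact H].
simpl ((1 + w ^ 2) ^ S m).
apply Rmult_le_compat_l; [lra|].
rewrite <- RPow_abs; apply pow_incr; split; [apply Rabs_pos|].
assert (Hq : Rabs w * Rabs w = w ^ 2)
  by (rewrite <- Rabs_mult, Rabs_right; [ring | nra]).
generalize (Rabs_pos w); nra.
Qed.

Lemma continuous_C_pair (f g : R -> R) (x : R) :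
  continuous f x -> continuous g x ->
  @continuous R_UniformSpace C_R_CompleteNormedModule (fun y => (f y, g y)) x.
Proof.
intros Hf Hg.
apply (continuous_comp_2 (V := R_UniformSpace) (W := R_UniformSpace)
  (X := C_UniformSpace) _ _ (fun p q => (p, q))); [exact Hf | exact Hg |].
apply (continuous_ext (fun z : C_UniformSpace => z)); [intros []; reflexivity|].
apply continuous_id.
Qed.

Lemma gauss_mode_continuous (c d xi : R) (m : nat) (w : R) :
  @continuous R_UniformSpace C_R_CompleteNormedModule (gauss_mode c d xi m) w.
Proof.
apply continuous_Cmult; apply continuous_C_pair; cbn [fst snd];
  apply (@ex_derive_continuous R_AbsRing R_NormedModule); auto_derive; trivial.
Qed.

Definition gauss_moment (c d : R) (m : nat) (xi : R) : C :=
  @RInt_gen C_R_CompleteNormedModule (gauss_mode c d xi m)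
    (Rbar_locally m_infty) (Rbar_locally p_infty).

Lemma gauss_moment_correct (c d xi : R) (m : nat) : 0 < c ->
  is_CInt_R (gauss_mode c d xi m) (gauss_moment c d m xi).
Proof.
intros Hc; destruct (gauss_mode_bound c d m Hc) as [B HB].
apply (dominated_is_RInt_gen _ B); [apply gauss_mode_continuous | apply HB].
Qed.

Lemma gauss_mode_derivative (c d xi : R) (m : nat) (a b : R) :
  is_CInt (fun w => (RtoC (INR m) * gauss_mode c d xi (pred m) w
      + (- (2 * c), 2 * d)%R * gauss_mode c d xi (S m) w
      + - (Ci * RtoC xi) * gauss_mode c d xi m w)%C) a b
    (gauss_mode c d xi m b - gauss_mode c d xi m a)%C.
Proof.
apply is_CInt_pair.
- apply (is_RInt_derive (fun w => fst (gauss_mode c d xi m w))).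
  + intros x _; unfold gauss_mode, Cexp; simpl.
    auto_derive; [trivial|].
    unfold Rminus; ring.
  + intros x _; apply (@ex_derive_continuous R_AbsRing R_NormedModule).
    unfold gauss_mode, Cexp; simpl; auto_derive; trivial.
- apply (is_RInt_derive (fun w => snd (gauss_mode c d xi m w))).
  + intros x _; unfold gauss_mode, Cexp; simpl.
    auto_derive; [trivial|].
    unfold Rminus; ring.
  + intros x _; apply (@ex_derive_continuous R_AbsRing R_NormedModule).
    unfold gauss_mode, Cexp; simpl; auto_derive; trivial.
Qed.

Lemma cauchy_density_vanishes (B eps : R) : 0 < eps ->
  exists M, 0 < M /\ forall w, M < Rabs w -> B / (1 + w ^ 2) < eps.
Proof.
intros He; exists (1 + Rabs B / eps); split.
- assert (0 <= Rabs B / eps); [|lra].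
  apply Rmult_le_pos; [apply Rabs_pos | apply Rlt_le, Rinv_0_lt_compat, He].
- intros w Hw.
  assert (Hq : Rabs w * Rabs w = w ^ 2)
    by (rewrite <- Rabs_mult, Rabs_right; [ring | nra]).
  apply Rlt_div_l; [nra|].
  apply Rle_lt_trans with (Rabs B); [apply Rle_abs|].
  assert (Hb : Rabs B = Rabs B / eps * eps) by (field; lra).
  assert (0 <= Rabs B / eps)
    by (apply Rmult_le_pos; [apply Rabs_pos | apply Rlt_le, Rinv_0_lt_compat, He]).
  set (r := Rabs B / eps) in *. rewrite Hb, Rmult_comm.
  apply Rmult_lt_compat_l; [exact He|]. rewrite <- Hq; nra.
Qed.

(** Integration by parts: [gauss_mode_derivative] integrates the derivative of
    [gauss_mode c d xi m], and the boundary terms vanish at infinity.  For [m = 0] the value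
    [pred 0 = 0] is harmless, its coefficient being [0]. *)
Lemma gauss_moment_recurrence (c d xi : R) (m : nat) : 0 < c ->
  (RtoC (INR m) * gauss_moment c d (pred m) xi
    + (- (2 * c), 2 * d)%R * gauss_moment c d (S m) xi
    + - (Ci * RtoC xi) * gauss_moment c d m xi = 0)%C.
Proof.
intros Hc.
eapply is_CInt_R_unique.
{ apply is_CInt_R_plus; [apply is_CInt_R_plus|];
    apply is_CInt_R_Cmult; apply gauss_moment_correct, Hc. }
destruct (gauss_mode_bound c d m Hc) as [B HB].
intros P HP; apply locally_C_Cmod in HP; destruct HP as [e He].
destruct (cauchy_density_vanishes B (e / 2)) as [M [HM0 HM]];
  [generalize (cond_pos e); lra|].
exists (fun x => x < - M) (fun x => M < x);
  [exists (- M); auto | exists M; auto |].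
intros a b Ha Hb; eexists; split; [apply gauss_mode_derivative|].
apply He; simpl fst; simpl snd.
replace (gauss_mode c d xi m b - gauss_mode c d xi m a - 0)%C
  with (gauss_mode c d xi m b + - gauss_mode c d xi m a)%C by ring.
eapply Rle_lt_trans; [apply Cmod_triangle|]; rewrite Cmod_opp.
assert (H1 := HM a ltac:(rewrite Rabs_left; lra)).
assert (H2 := HM b ltac:(rewrite Rabs_right; lra)).
generalize (HB xi a) (HB xi b); lra.
Qed.

(** By the recurrence a factor [xi] turns the moment of order [m] into a combination, with
    coefficients independent of [xi], of moments of neighbouring orders.  The moments
    themselves are bounded uniformly in [xi]. *)
Lemma gauss_moment_decay (c d : R) (N : nat) : 0 < c ->
  forall m, exists B, forall xi, Rabs xi ^ N * Cmod (gauss_moment c d m xi) <= B.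
Proof.
intros Hc; induction N as [|N IH]; intros m.
- destruct (gauss_mode_bound c d m Hc) as [B HB].
  exists (B * PI); intros xi; simpl; rewrite Rmult_1_l.
  exact (dominated_is_RInt_gen_bound _ B _ (HB xi) (gauss_moment_correct c d xi m Hc)).
- destruct (IH (pred m)) as [B1 H1]; destruct (IH (S m)) as [B2 H2].
  exists (INR m * B1 + Cmod (- (2 * c), 2 * d)%R * B2); intros xi.
  specialize (H1 xi); specialize (H2 xi).
  assert (Hr := gauss_moment_recurrence c d xi m Hc).
  assert (He : (Ci * RtoC xi * gauss_moment c d m xi)%C =
    (RtoC (INR m) * gauss_moment c d (pred m) xi
    + (- (2 * c), 2 * d)%R * gauss_moment c d (S m) xi)%C).
  { rewrite <- (Cplus_0_r (Ci * _ * _)%C), <- Hr; ring. }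
  apply (f_equal Cmod) in He.
  rewrite !Cmod_mult, Cmod_Ci, Cmod_R, Rmult_1_l in He.
  simpl; rewrite (Rmult_comm (Rabs xi)), Rmult_assoc, He.
  eapply Rle_trans.
  { apply Rmult_le_compat_l; [apply pow_le, Rabs_pos | apply Cmod_triangle]. }
  rewrite !Cmod_mult, Cmod_R, (Rabs_right (INR m)) by (apply Rle_ge, pos_INR).
  assert (Hm := pos_INR m); assert (Hcd := Cmod_ge_0 (- (2 * c), 2 * d)%R).
  nra.
Qed.

(** Decay of order four makes the bound at [xi = sqrt t * k] integrable over [0 < t], with
    integral of order [1 / k ^ 2]. *)
Lemma gauss_moment_bound (c d : R) : 0 < c ->
  exists B, 0 <= B /\ forall xi, Cmod (gauss_moment c d 0 xi) <= B / (1 + xi ^ 2) ^ 2.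
Proof.
intros Hc.
destruct (gauss_moment_decay c d 0 Hc 0%nat) as [B0 H0].
destruct (gauss_moment_decay c d 4 Hc 0%nat) as [B4 H4].
assert (HB : forall xi, Cmod (gauss_moment c d 0 xi) <= 2 * (B0 + B4) / (1 + xi ^ 2) ^ 2).
{ intros xi; specialize (H0 xi); specialize (H4 xi).
  assert (Hq : Rabs xi * Rabs xi = xi ^ 2)
    by (rewrite <- Rabs_mult, Rabs_right; [ring | nra]).
  apply (Rle_div_r _ _ ((1 + xi ^ 2) ^ 2)); [nra|].
  simpl in H0; replace (Rabs xi ^ 4) with ((Rabs xi * Rabs xi) ^ 2) in H4 by ring.
  rewrite Hq in H4.
  assert (Hg := Cmod_ge_0 (gauss_moment c d 0 xi)).
  set (g := Cmod _) in *. set (y := xi ^ 2) in *.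
  (* [(1 + y)^2 <= 2 (1 + y^2)] *)
  assert (g * (1 - y) ^ 2 >= 0) by (apply Rle_ge, Rmult_le_pos; [exact Hg | apply pow2_ge_0]).
  nra. }
exists (2 * (B0 + B4)); split; [|exact HB].
generalize (HB 0) (Cmod_ge_0 (gauss_moment c d 0 0)).
replace (2 * (B0 + B4) / (1 + 0 ^ 2) ^ 2) with (2 * (B0 + B4)) by (simpl; field); lra.
Qed.


(** * Modes and the distance to their closed span *)

Definition cis (y : R) : C := Cexp (Ci * RtoC y)%C.

Lemma cis_eq (y : R) : cis y = (cos y, sin y).
Proof.
unfold cis, Cexp; simpl.
replace (0 * y - 1 * 0) with 0 by ring; replace (0 * 0 + 1 * y) with y by ring.
rewrite exp_0; f_equal; ring.
Qed.

Lemma cis_plus (x y : R) : cis (x + y) = (cis x * cis y)%C.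
Proof.
rewrite !cis_eq, cos_plus, sin_plus; unfold Cmult; simpl; f_equal; ring.
Qed.

Lemma cis_0 : cis 0 = 1%C.
Proof. rewrite cis_eq, cos_0, sin_0; reflexivity. Qed.

Lemma Cmod_cis (y : R) : Cmod (cis y) = 1.
Proof.
unfold cis; rewrite Cmod_Cexp; simpl.
replace (0 * y - 1 * 0) with 0 by ring; apply exp_0.
Qed.

Lemma lipschitz_1 (f df : R -> R) : (forall x, is_derive f x (df x)) ->
  (forall x, Rabs (df x) <= 1) -> forall x y, Rabs (f x - f y) <= Rabs (x - y).
Proof.
intros Hf Hd x y.
destruct (MVT_gen f y x df) as [c [_ ->]].
- intros; apply Hf.
- intros z _; apply derivable_continuous_pt.
  exists (df z); apply is_derive_Reals, Hf.
- rewrite Rabs_mult; generalize (Hd c) (Rabs_pos (x - y)); nra.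
Qed.

Lemma cis_lipschitz (x y : R) : Cmod (cis x - cis y)%C <= 2 * Rabs (x - y).
Proof.
rewrite !cis_eq.
assert (H1 : Rabs (cos x - cos y) <= Rabs (x - y)).
{ apply (lipschitz_1 cos (fun t => - sin t)).
  - intros t; auto_derive; trivial; ring.
  - intros t; rewrite Rabs_Ropp; apply Rabs_le, SIN_bound. }
assert (H2 : Rabs (sin x - sin y) <= Rabs (x - y)).
{ apply (lipschitz_1 sin cos).
  - intros t; auto_derive; trivial; ring.
  - intros t; apply Rabs_le, COS_bound. }
replace ((cos x, sin x) - (cos y, sin y))%C
  with (RtoC (cos x - cos y) + Ci * RtoC (sin x - sin y))%C
  by (apply injective_projections; simpl; ring).
eapply Rle_trans; [apply Cmod_triangle|].
rewrite Cmod_mult, Cmod_Ci, !Cmod_R; lra.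
Qed.

Lemma is_Cu_cis (k : R) : is_Cu (fun x => cis (k * x)%R).
Proof.
split.
- exists 1; intros x; rewrite Cmod_cis; lra.
- intros eps; assert (Hk := Rabs_pos k).
  assert (Hd : 0 < eps / (2 * Rabs k + 1))
    by (apply Rdiv_lt_0_compat; [apply cond_pos | lra]).
  exists (mkposreal _ Hd); intros x y Hxy; simpl in Hxy.
  eapply Rle_lt_trans; [apply cis_lipschitz|].
  rewrite <- Rmult_minus_distr_l, Rabs_mult.
  assert (He : pos eps = eps / (2 * Rabs k + 1) * (2 * Rabs k + 1)) by (field; lra).
  set (d := eps / (2 * Rabs k + 1)) in *; rewrite He.
  generalize (Rabs_pos (x - y)); nra.
Qed.

Lemma is_Cu_mode (lambda : R) (c : C) (j : nat) :
  is_Cu (fun x => c * cis (x * INR (S j) * lambda)%R)%C.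
Proof.
apply is_Cu_mult; [apply is_Cu_const|].
replace (fun x => cis (x * INR (S j) * lambda))
  with (fun x => cis (INR (S j) * lambda * x)); [apply is_Cu_cis|].
apply FunctionalExtensionality.functional_extensionality; intros x; f_equal; ring.
Qed.

Definition mode (lambda : R) (c : C) (j : nat) : Cu := mkCu _ (is_Cu_mode lambda c j).

(** Scalars are built into the modes, so an additive map is determined on trigonometric
    polynomials by its values on modes. *)
Inductive trig_poly (lambda : R) : Cu -> Prop :=
| trig_mode c j : trig_poly lambda (mode lambda c j)
| trig_plus p q : trig_poly lambda p -> trig_poly lambda q ->
    trig_poly lambda (Cu_plus p q).

Definition bounded_by (M : R) (v : Cu) : Prop := forall x, Cmod (v x) <= M.

Definition Cu_sub (v w : Cu) : Cu := Cu_plus v (Cu_opp w).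

Lemma Cu_sub_eq (v w : Cu) (x : R) : Cu_sub v w x = (v x - w x)%C.
Proof. simpl; ring. Qed.

Lemma Cu_sub_plus (v w : Cu) : Cu_plus (Cu_sub v w) w = v.
Proof. apply Cu_ext; intros x; simpl; ring. Qed.

(** The distance to the span of the modes, encoded as a relation between [r] and [v] rather
    than as an infimum: in this form it fits [closed_cone_RInt_majorant].  The closed span
    itself is [near lambda 0]. *)
Definition near (lambda r : R) (v : Cu) : Prop :=
  forall eps, 0 < eps -> exists p, trig_poly lambda p /\ bounded_by (r + eps) (Cu_sub v p).

Lemma trig_zero (lambda : R) : trig_poly lambda Cu_zero.
Proof.
replace Cu_zero with (mode lambda 0 0); [constructor|].
apply Cu_ext; intros x; simpl; ring.
Qed.

Lemma trig_scal (lambda : R) (c : C) (p : Cu) :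
  trig_poly lambda p -> trig_poly lambda (Cu_scal c p).
Proof.
induction 1 as [a j | p q _ IHp _ IHq].
- replace (Cu_scal c (mode lambda a j)) with (mode lambda (c * a)%C j);
    [constructor | apply Cu_ext; intros x; simpl; ring].
- replace (Cu_scal c (Cu_plus p q)) with (Cu_plus (Cu_scal c p) (Cu_scal c q));
    [constructor; assumption | apply Cu_ext; intros x; simpl; ring].
Qed.

Definition Cu_mult (u v : Cu) : Cu :=
  mkCu _ (is_Cu_mult _ _ (Cu_is_Cu u) (Cu_is_Cu v)).

(** The product of the modes [j] and [k] is the mode [j + k + 1]: the positive frequencies form
    a semigroup. *)
Lemma trig_mult (lambda : R) (p q : Cu) :
  trig_poly lambda p -> trig_poly lambda q -> trig_poly lambda (Cu_mult p q).
Proof.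
intros Hp Hq; induction Hp as [a j | p1 p2 _ IH1 _ IH2].
- induction Hq as [b k | q1 q2 _ IH1 _ IH2].
  + replace (Cu_mult (mode lambda a j) (mode lambda b k))
      with (mode lambda (a * b)%C (S (j + k))); [constructor|].
    apply Cu_ext; intros x.
    change ((a * b * cis (x * INR (S (S (j + k))) * lambda))%C
      = ((a * cis (x * INR (S j) * lambda)) * (b * cis (x * INR (S k) * lambda)))%C).
    replace (x * INR (S (S (j + k))) * lambda)
      with (x * INR (S j) * lambda + x * INR (S k) * lambda)
      by (rewrite !S_INR, plus_INR; ring).
    rewrite cis_plus; ring.
  + replace (Cu_mult (mode lambda a j) (Cu_plus q1 q2))
      with (Cu_plus (Cu_mult (mode lambda a j) q1) (Cu_mult (mode lambda a j) q2));
      [constructor; assumption | apply Cu_ext; intros x; simpl; ring].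
- replace (Cu_mult (Cu_plus p1 p2) q)
    with (Cu_plus (Cu_mult p1 q) (Cu_mult p2 q));
    [constructor; assumption | apply Cu_ext; intros x; simpl; ring].
Qed.

Lemma trig_pow (lambda : R) (n : nat) (p : Cu) :
  trig_poly lambda p -> trig_poly lambda (Cu_pow p (S n)).
Proof.
intros Hp; induction n as [|n IH].
- replace (Cu_pow p 1) with p; [exact Hp | apply Cu_ext; intros x; simpl; ring].
- replace (Cu_pow p (S (S n))) with (Cu_mult p (Cu_pow p (S n)));
    [apply trig_mult; assumption | apply Cu_ext; intros x; simpl; ring].
Qed.

Lemma bounded_by_plus (M N : R) (v w : Cu) :
  bounded_by M v -> bounded_by N w -> bounded_by (M + N) (Cu_plus v w).
Proof.
intros Hv Hw x; simpl; eapply Rle_trans; [apply Cmod_triangle|].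
apply Rplus_le_compat; auto.
Qed.

Lemma bounded_by_scal (c : C) (M : R) (v : Cu) :
  bounded_by M v -> bounded_by (Cmod c * M) (Cu_scal c v).
Proof.
intros Hv x; simpl; rewrite Cmod_mult; apply Rmult_le_compat_l;
  [apply Cmod_ge_0 | apply Hv].
Qed.

Lemma bounded_by_le (M N : R) (v : Cu) : M <= N -> bounded_by M v -> bounded_by N v.
Proof. intros H Hv x; eapply Rle_trans; [apply Hv | exact H]. Qed.

Lemma bounded_by_nonneg (M : R) (v : Cu) : bounded_by M v -> 0 <= M.
Proof. intros H; eapply Rle_trans; [apply (Cmod_ge_0 (v 0)) | apply H]. Qed.

Lemma near_le (lambda r s : R) (v : Cu) : r <= s -> near lambda r v -> near lambda s v.
Proof.
intros Hrs H eps He; destruct (H eps He) as [p [Hp Hb]]; exists p; split; [exact Hp|].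
apply (bounded_by_le (r + eps)); [lra | exact Hb].
Qed.

Lemma near_bounded (lambda M : R) (v : Cu) : bounded_by M v -> near lambda M v.
Proof.
intros H eps He; exists Cu_zero; split; [apply trig_zero|].
intros x; rewrite Cu_sub_eq; simpl.
replace (v x - 0)%C with (v x) by ring; generalize (H x); lra.
Qed.

Lemma near_trig (lambda : R) (p : Cu) : trig_poly lambda p -> near lambda 0 p.
Proof.
intros H eps He; exists p; split; [exact H|].
intros x; rewrite Cu_sub_eq; replace (p x - p x)%C with (RtoC 0) by ring.
rewrite Cmod_0; lra.
Qed.

Lemma near_plus (lambda r s : R) (v w : Cu) :
  near lambda r v -> near lambda s w -> near lambda (r + s) (Cu_plus v w).
Proof.
intros Hv Hw eps He.
destruct (Hv (eps / 2)) as [p [Hp Hbp]]; [lra|].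
destruct (Hw (eps / 2)) as [q [Hq Hbq]]; [lra|].
exists (Cu_plus p q); split; [constructor; assumption|].
replace (r + s + eps) with ((r + eps / 2) + (s + eps / 2)) by field.
replace (Cu_sub (Cu_plus v w) (Cu_plus p q)) with (Cu_plus (Cu_sub v p) (Cu_sub w q));
  [apply bounded_by_plus; assumption | apply Cu_ext; intros x; simpl; ring].
Qed.

(** [T] maps a polynomial approximating [v] to a polynomial approximating [T v]. *)
Lemma near_operator (lambda r K : R) (T : Cu -> Cu) (v : Cu) : 0 <= K ->
  (forall v w, T (Cu_plus v w) = Cu_plus (T v) (T w)) ->
  (forall M v, bounded_by M v -> bounded_by (K * M) (T v)) ->
  (forall c j, trig_poly lambda (T (mode lambda c j))) ->
  near lambda r v -> near lambda (K * r) (T v).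
Proof.
intros HK Tp Tb Tm H eps He.
destruct (H (eps / (K + 1))) as [p [Hp Hb]]; [apply Rdiv_lt_0_compat; lra|].
exists (T p); split.
- clear Hb; induction Hp as [c j | p q _ IHp _ IHq]; [apply Tm|].
  rewrite Tp; constructor; assumption.
- replace (Cu_sub (T v) (T p)) with (T (Cu_sub v p)).
  + apply (bounded_by_le (K * (r + eps / (K + 1)))); [|apply Tb, Hb].
    assert (He' : eps = eps / (K + 1) * (K + 1)) by (field; lra).
    assert (0 < eps / (K + 1)) by (apply Rdiv_lt_0_compat; lra).
    set (d := eps / (K + 1)) in *. rewrite He'; nra.
  + rewrite <- (Cu_sub_plus v p) at 2; rewrite Tp.
    apply Cu_ext; intros x; simpl; ring.
Qed.

Lemma near_scal (lambda r : R) (c : C) (v : Cu) :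
  near lambda r v -> near lambda (Cmod c * r) (Cu_scal c v).
Proof.
apply (near_operator lambda r (Cmod c) (Cu_scal c)).
- apply Cmod_ge_0.
- intros a b; apply Cu_ext; intros x; simpl; ring.
- intros M a; apply bounded_by_scal.
- intros a j; apply trig_scal; constructor.
Qed.

Lemma near_closed (lambda r : R) (v : Cu) :
  (forall eps, 0 < eps -> exists r' v',
     near lambda r' v' /\ r' <= r + eps /\ bounded_by eps (Cu_sub v v')) ->
  near lambda r v.
Proof.
intros H eps He; destruct (H (eps / 3)) as [r' [v' [Hn [Hr Hb]]]]; [lra|].
destruct (Hn (eps / 3)) as [p [Hp Hbp]]; [lra|].
exists p; split; [exact Hp|].
apply (bounded_by_le (eps / 3 + (r' + eps / 3))); [lra|].
replace (Cu_sub v p) with (Cu_plus (Cu_sub v v') (Cu_sub v' p));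
  [apply bounded_by_plus; assumption | apply Cu_ext; intros x; simpl; ring].
Qed.

Lemma Cpow_lipschitz (n : nat) (M : R) : 0 <= M ->
  exists L, 0 <= L /\ forall a b : C, Cmod a <= M -> Cmod b <= M ->
    Cmod (Cpow a n - Cpow b n)%C <= L * Cmod (a - b)%C.
Proof.
intros HM; induction n as [|n [L [HL IH]]].
- exists 0; split; [lra|]; intros a b _ _; simpl.
  replace (1 - 1)%C with (RtoC 0) by ring; rewrite Cmod_0; lra.
- exists (M * L + M ^ n); split; [generalize (pow_le M n HM); nra|].
  intros a b Ha Hb; simpl.
  replace (a * Cpow a n - b * Cpow b n)%C
    with (a * (Cpow a n - Cpow b n) + (a - b) * Cpow b n)%C by ring.
  eapply Rle_trans; [apply Cmod_triangle|]; rewrite !Cmod_mult.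
  specialize (IH a b Ha Hb).
  assert (Hbn : Cmod (Cpow b n) <= M ^ n)
    by (rewrite Cmod_pow; apply pow_incr; split; [apply Cmod_ge_0 | exact Hb]).
  assert (H0 := Cmod_ge_0 (a - b)%C); assert (H1 := Cmod_ge_0 a).
  assert (H2 := Cmod_ge_0 (Cpow a n - Cpow b n)%C).
  assert (Cmod a * Cmod (Cpow a n - Cpow b n) <= M * (L * Cmod (a - b)))
    by (apply Rmult_le_compat; assumption).
  assert (Cmod (a - b) * Cmod (Cpow b n) <= Cmod (a - b) * M ^ n)
    by (apply Rmult_le_compat_l; assumption).
  lra.
Qed.

(** If [r <= M], compare [v ^ (n+1)] with [p ^ (n+1)] for a polynomial [p] at distance about
    [r] from [v]; then [p] is bounded by [2 M + 1].  If [r > M], the Lipschitz bound between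
    [v] and [0] already suffices.  The constant [L] thus depends on [M] and not on [r]. *)
Lemma near_pow (lambda M : R) (n : nat) : 0 <= M ->
  exists L, 0 <= L /\ forall r v, 0 <= r -> bounded_by M v -> near lambda r v ->
    near lambda (L * r) (Cu_pow v (S n)).
Proof.
intros HM.
destruct (Cpow_lipschitz (S n) (2 * M + 1)) as [L [HL HLip]]; [lra|].
exists L; split; [exact HL|]; intros r v Hr Hv Hn.
destruct (Rle_dec r M) as [HrM | HrM].
- intros eps He.
  assert (Hd : 0 < Rmin 1 (eps / (L + 1)))
    by (apply Rmin_glb_lt; [lra | apply Rdiv_lt_0_compat; lra]).
  destruct (Hn _ Hd) as [p [Hp Hb]].
  exists (Cu_pow p (S n)); split; [apply trig_pow, Hp|].
  intros x; rewrite Cu_sub_eq.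
  specialize (Hb x); rewrite Cu_sub_eq in Hb; specialize (Hv x).
  assert (H1 := Rmin_l 1 (eps / (L + 1))); assert (H2 := Rmin_r 1 (eps / (L + 1))).
  assert (Hpx : Cmod (p x) <= 2 * M + 1).
  { replace (p x) with (v x + - (v x - p x))%C by ring.
    eapply Rle_trans; [apply Cmod_triangle|]; rewrite Cmod_opp; lra. }
  eapply Rle_trans; [apply (HLip (v x) (p x)); lra|].
  assert (He' : eps = eps / (L + 1) * (L + 1)) by (field; lra).
  set (d := eps / (L + 1)) in *; rewrite He'.
  assert (0 < d) by lra. nra.
- apply (near_le lambda (L * M)); [nra|].
  apply near_bounded; intros x; specialize (Hv x).
  replace (Cu_pow v (S n) x) with (Cpow (v x) (S n) - Cpow 0 (S n))%C
    by (simpl; ring).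
  eapply Rle_trans; [apply HLip; rewrite ?Cmod_0; lra|].
  replace (v x - 0)%C with (v x) by ring.
  apply Rmult_le_compat_l; lra.
Qed.

(** * The semigroup on modes *)

Lemma convolution_is_CInt (alpha beta gamma t : R) (v : Cu) (x : R) :
  0 < alpha -> 0 < t ->
  is_CInt_R (fun y => heat_kernel alpha beta gamma t y * v (x - y)%R)%C
    (convolution (heat_kernel alpha beta gamma t) v x).
Proof.
intros Ha Ht.
destruct (heat_kernel_bound alpha beta gamma t Ha Ht) as [K HK].
apply (dominated_is_RInt_gen _ (K * Cu_norm v)).
- intros y; apply continuous_Cmult; [apply heat_kernel_continuous; assumption|].
  apply (continuous_comp (fun y => x - y) v); [|apply Cu_continuous].
  apply (@ex_derive_continuous R_AbsRing R_NormedModule); auto_derive; trivial.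
- intros y; rewrite Cmod_mult.
  replace (K * Cu_norm v / (1 + y ^ 2)) with (K / (1 + y ^ 2) * Cu_norm v)
    by (unfold Rdiv; ring).
  apply Rmult_le_compat; auto using Cmod_ge_0, Cu_norm_ub.
Qed.

(** The substitution [y = sqrt t * w] turns the heat kernel into a fixed Gaussian times a
    constant [A] whose modulus depends on [t] only through [exp (gamma * t)]. *)
Lemma semigroup_rescaled (alpha beta gamma t : R) : 0 < alpha -> 0 < t ->
  exists A : C, Cmod A = exp (gamma * t) / sqrt (4 * PI * Cmod (alpha, beta)) /\
  forall (v : Cu) (x : R), is_CInt_R
    (fun w => A * (gauss_mode (alpha / (4 * (alpha ^ 2 + beta ^ 2)))
         (beta / (4 * (alpha ^ 2 + beta ^ 2))) 0 0 w * v (x - sqrt t * w)%R))%C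
    (semigroup alpha beta gamma t v x).
Proof.
intros Ha Ht.
assert (Hst := sqrt_lt_R0 t Ht).
assert (Hss := sqrt_sqrt t (Rlt_le _ _ Ht)).
assert (Hz : 0 < Cmod (alpha, beta)).
{ apply Cmod_gt_0; intros H; injection H; lra. }
assert (HPI := PI_RGT_0).
set (Z := (RtoC (4 * PI * t) * (alpha, beta))%C).
assert (HZ : Cmod (Csqrt Z) = sqrt t * sqrt (4 * PI * Cmod (alpha, beta))).
{ rewrite <- sqrt_mult; [|lra | nra].
  rewrite <- (sqrt_square (Cmod (Csqrt Z))) by apply Cmod_ge_0.
  f_equal; rewrite <- Cmod_mult, Csqrt_square; unfold Z.
  rewrite Cmod_mult, Cmod_R, Rabs_right by nra; ring. }
assert (Hq : 0 < sqrt (4 * PI * Cmod (alpha, beta))) by (apply sqrt_lt_R0; nra).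
assert (HZ0 : Csqrt Z <> 0%C).
{ apply Cmod_gt_0; rewrite HZ; nra. }
exists (RtoC (sqrt t) * (/ Csqrt Z * RtoC (exp (gamma * t))))%C; split.
- rewrite !Cmod_mult, Cmod_inv, !Cmod_R, HZ by exact HZ0.
  rewrite !Rabs_right by (apply Rle_ge; try apply Rlt_le, exp_pos; lra).
  field; lra.
- intros v x; rewrite semigroup_pos by assumption.
  assert (H := is_CInt_R_rescale (sqrt t) _ _ Hst
    (convolution_is_CInt alpha beta gamma t v x Ha Ht)).
  revert H; apply is_CInt_R_ext; intros w.
  unfold heat_kernel; fold Z.
  rewrite heat_kernel_exponent by assumption.
  assert (0 < alpha ^ 2 + beta ^ 2) by nra.
  replace (alpha * (sqrt t * w) ^ 2 / (4 * t * (alpha ^ 2 + beta ^ 2)))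
    with (alpha / (4 * (alpha ^ 2 + beta ^ 2)) * w ^ 2)
    by (rewrite Rpow_mult_distr; simpl (sqrt t ^ 2); rewrite Rmult_1_r, Hss; field; lra).
  replace (beta * (sqrt t * w) ^ 2 / (4 * t * (alpha ^ 2 + beta ^ 2)))
    with (beta / (4 * (alpha ^ 2 + beta ^ 2)) * w ^ 2)
    by (rewrite Rpow_mult_distr; simpl (sqrt t ^ 2); rewrite Rmult_1_r, Hss; field; lra).
  unfold gauss_mode; simpl (w ^ 0).
  rewrite Rmult_0_l, Rminus_0_r.
  set (c := alpha / _ * _); set (d := beta / _ * _).
  replace (Cexp (- c + gamma * t, d)%R) with (RtoC (exp (gamma * t)) * Cexp (- c, d)%R)%C
    by (unfold Cexp, Cmult, RtoC; simpl; rewrite exp_plus; f_equal; ring).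
  ring.
Qed.

Lemma gauss_mode_modulate (c d xi w : R) :
  (gauss_mode c d 0 0 w * cis (- (xi * w)))%C = gauss_mode c d xi 0 w.
Proof.
unfold gauss_mode; rewrite cis_eq; unfold Cexp; simpl fst; simpl snd.
replace (d * (w * (w * 1)) - 0 * w) with (d * (w * (w * 1))) by ring.
unfold Rminus; rewrite cos_plus, sin_plus.
unfold Cmult, RtoC; simpl; f_equal; ring.
Qed.

(** The multipliers of the semigroup are the Gaussian Fourier transform at
    frequency [sqrt t * k]; the constant [K] depends neither on [t] nor on [k]. *)
Lemma semigroup_multiplier (alpha beta gamma : R) : 0 < alpha ->
  exists K, 0 <= K /\ forall t, 0 <= t ->
    (forall v w, semigroup alpha beta gamma t (Cu_plus v w) =
       Cu_plus (semigroup alpha beta gamma t v) (semigroup alpha beta gamma t w)) /\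
    (forall M v, bounded_by M v ->
       bounded_by (K * exp (gamma * t) * M) (semigroup alpha beta gamma t v)) /\
    exists mu : R -> C,
      (forall k, Cmod (mu k) <= K * exp (gamma * t) / (1 + k ^ 2 * t) ^ 2) /\
      forall lambda c j, semigroup alpha beta gamma t (mode lambda c j) =
        mode lambda (mu (INR (S j) * lambda)%R * c)%C j.
Proof.
intros Ha.
set (c0 := alpha / (4 * (alpha ^ 2 + beta ^ 2))).
set (d0 := beta / (4 * (alpha ^ 2 + beta ^ 2))).
assert (Hc0 : 0 < c0) by (apply Rdiv_lt_0_compat; nra).
set (Q := / sqrt (4 * PI * Cmod (alpha, beta))).
assert (HPI := PI_RGT_0).
assert (HQ : 0 < Q).
{ apply Rinv_0_lt_compat, sqrt_lt_R0.
  assert (0 < Cmod (alpha, beta)) by (apply Cmod_gt_0; intros H; injection H; lra).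
  nra. }
destruct (gauss_mode_bound c0 d0 0 Hc0) as [B HB].
assert (HB0 : 0 <= B).
{ generalize (HB 0 0) (Cmod_ge_0 (gauss_mode c0 d0 0 0 0)).
  replace (B / (1 + 0 ^ 2)) with B by (simpl; field); lra. }
destruct (gauss_moment_bound c0 d0 Hc0) as [D [HD0 HD]].
exists (1 + Q * B * PI + Q * D).
assert (HK1 : 0 <= Q * B * PI) by (apply Rmult_le_pos; [apply Rmult_le_pos|]; lra).
assert (HK2 : 0 <= Q * D) by (apply Rmult_le_pos; lra).
split; [lra|]; intros t Ht.
destruct (Rle_lt_or_eq_dec 0 t Ht) as [Htp | <-].
- assert (Hst := sqrt_lt_R0 t Htp).
  assert (Hss := sqrt_sqrt t (Rlt_le _ _ Htp)).
  destruct (semigroup_rescaled alpha beta gamma t Ha Htp) as [A [HA HU]].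
  fold c0 d0 in HU.
  assert (He := exp_pos (gamma * t)).
  assert (HA' : Cmod A = Q * exp (gamma * t))
    by (rewrite HA; unfold Q, Rdiv; ring).
  split; [|split].
  + intros v w; apply Cu_ext; intros x.
    eapply is_CInt_R_unique; [apply HU|]; simpl.
    generalize (is_CInt_R_plus _ _ _ _ (HU v x) (HU w x)); apply is_CInt_R_ext.
    intros y; simpl; ring.
  + intros M v Hv x.
    assert (HM := bounded_by_nonneg M v Hv).
    apply Rle_trans with (Q * exp (gamma * t) * B * M * PI).
    * refine (dominated_is_RInt_gen_bound _ _ _ _ (HU v x)); intros y.
      rewrite !Cmod_mult, HA'.
      specialize (HB 0 y); specialize (Hv (x - sqrt t * y)).
      replace (Q * exp (gamma * t) * B * M / (1 + y ^ 2))
        with (Q * exp (gamma * t) * (B / (1 + y ^ 2) * M)) by (unfold Rdiv; ring).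
      apply Rmult_le_compat_l; [nra|].
      apply Rmult_le_compat; auto using Cmod_ge_0.
    * replace (Q * exp (gamma * t) * B * M * PI)
        with (Q * B * PI * (exp (gamma * t) * M)) by ring.
      rewrite (Rmult_assoc _ (exp _)).
      apply Rmult_le_compat_r; [nra | lra].
  + exists (fun k => A * gauss_moment c0 d0 0 (sqrt t * k)%R)%C; split.
    * intros k; rewrite Cmod_mult, HA'.
      specialize (HD (sqrt t * k)).
      replace ((sqrt t * k) ^ 2) with (k ^ 2 * t) in HD
        by (rewrite <- Hss at 1; ring).
      assert (Hp : 0 < (1 + k ^ 2 * t) ^ 2) by (apply pow_lt; nra).
      apply Rle_trans with (Q * exp (gamma * t) * (D / (1 + k ^ 2 * t) ^ 2)).
      { apply Rmult_le_compat_l; [nra | exact HD]. }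
      replace (Q * exp (gamma * t) * (D / (1 + k ^ 2 * t) ^ 2))
        with (Q * D * (exp (gamma * t) / (1 + k ^ 2 * t) ^ 2)) by (unfold Rdiv; ring).
      unfold Rdiv at 2; rewrite (Rmult_assoc _ (exp _)); fold (exp (gamma * t) / (1 + k ^ 2 * t) ^ 2).
      apply Rmult_le_compat_r; [|lra].
      apply Rlt_le, Rdiv_lt_0_compat; assumption.
    * intros lambda c j; apply Cu_ext; intros x.
      eapply is_CInt_R_unique; [apply HU|].
      set (k := INR (S j) * lambda).
      replace (mode lambda (A * gauss_moment c0 d0 0 (sqrt t * k)%R * c)%C j x)
        with (A * (c * cis (k * x)%R) * gauss_moment c0 d0 0 (sqrt t * k)%R)%C.
      2:{ change (mode lambda (A * gauss_moment c0 d0 0 (sqrt t * k)%R * c)%C j x)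
            with (A * gauss_moment c0 d0 0 (sqrt t * k)%R * c
                  * cis (x * INR (S j) * lambda)%R)%C.
          replace (x * INR (S j) * lambda) with (k * x) by (unfold k; ring); ring. }
      generalize (is_CInt_R_Cmult (A * (c * cis (k * x)%R))%C _ _
        (gauss_moment_correct c0 d0 (sqrt t * k) 0 Hc0)).
      apply is_CInt_R_ext; intros w.
      rewrite <- gauss_mode_modulate.
      change (mode lambda c j (x - sqrt t * w))
        with (c * cis ((x - sqrt t * w) * INR (S j) * lambda)%R)%C.
      replace ((x - sqrt t * w) * INR (S j) * lambda)
        with (k * x + - (sqrt t * k * w)) by (unfold k; ring).
      rewrite cis_plus; ring.
- rewrite Rmult_0_r, exp_0, Rmult_1_r.
  split; [|split].
  + intros v w; rewrite !semigroup_0; reflexivity.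
  + intros M v Hv; rewrite semigroup_0.
    apply (bounded_by_le M); [|exact Hv].
    generalize (bounded_by_nonneg M v Hv); nra.
  + exists (fun _ => 1%C); split.
    * intros k; rewrite Rmult_0_r, Rplus_0_r, pow1, Cmod_1; lra.
    * intros lambda c j; rewrite semigroup_0.
      apply Cu_ext; intros x; simpl; ring.
Qed.


(** * Absolutely convergent series of modes *)

Lemma C_eq_of_Cmod_le (x y : C) :
  (forall eps, 0 < eps -> Cmod (x - y)%C <= eps) -> x = y.
Proof.
intros H.
assert (H0 : (x - y)%C = 0%C).
{ apply Cmod_eq_0, Rle_antisym; [|apply Cmod_ge_0].
  apply le_epsilon; intros eps He; rewrite Rplus_0_l; apply H, He. }
replace x with (y + (x - y))%C by ring; rewrite H0; ring.
Qed.

Lemma is_Cseries_iff (c : nat -> C) (l : C) :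
  @is_series C_AbsRing C_NormedModule c l <->
  forall eps, 0 < eps -> exists N, forall n, (N <= n)%nat ->
    Cmod (@sum_n C_AbelianMonoid c n - l)%C < eps.
Proof.
split.
- intros H eps He.
  apply (H (fun z => Cmod (z - l)%C < eps)).
  apply locally_C_Cmod; exists (mkposreal _ He); auto.
- intros H P HP; destruct (proj1 (locally_C_Cmod l P) HP) as [e He].
  destruct (H e (cond_pos e)) as [N HN]; exists N; intros n Hn; apply He, HN, Hn.
Qed.

Lemma Cu_norm_minus_bounded (eps : R) (v w : Cu) :
  norm (minus v w) < eps -> bounded_by eps (Cu_sub v w).
Proof.
intros H x; apply Rle_trans with (norm (minus v w)); [|lra].
exact (Cu_norm_ub (minus v w) x).
Qed.

Lemma Cu_sub_sym (eps : R) (v w : Cu) :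
  bounded_by eps (Cu_sub v w) -> bounded_by eps (Cu_sub w v).
Proof.
intros H x; specialize (H x); rewrite Cu_sub_eq in *.
replace (w x - v x)%C with (- (v x - w x))%C by ring; rewrite Cmod_opp; exact H.
Qed.

Lemma bounded_by_mode (lambda : R) (c : C) (j : nat) :
  bounded_by (Cmod c) (mode lambda c j).
Proof.
intros x; change (mode lambda c j x) with (c * cis (x * INR (S j) * lambda)%R)%C.
rewrite Cmod_mult, Cmod_cis; lra.
Qed.

Definition mode_sum (lambda : R) (a : nat -> C) (n : nat) : Cu :=
  @sum_n Cu_AbelianMonoid (fun j => mode lambda (a j) j) n.

Definition mode_series_to (lambda : R) (a : nat -> C) (G : Cu) : Prop :=
  forall eps, 0 < eps -> exists N, forall n, (N <= n)%nat ->
    bounded_by eps (Cu_sub (mode_sum lambda a n) G).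

Lemma trig_mode_sum (lambda : R) (a : nat -> C) (n : nat) :
  trig_poly lambda (mode_sum lambda a n).
Proof.
unfold mode_sum; induction n as [|n IH].
- rewrite sum_O; constructor.
- rewrite sum_Sn; apply trig_plus; [exact IH | constructor].
Qed.

Lemma mode_sum_eval (lambda : R) (a : nat -> C) (n : nat) (x : R) :
  mode_sum lambda a n x =
  @sum_n C_AbelianMonoid (fun j => (a j * cis (x * INR (S j) * lambda)%R)%C) n.
Proof.
unfold mode_sum; induction n as [|n IH].
- rewrite !sum_O; reflexivity.
- rewrite !sum_Sn, <- IH; reflexivity.
Qed.

Lemma mode_series (lambda : R) (a : nat -> C) : ex_series (fun j => Cmod (a j)) ->
  exists G : Cu, mode_series_to lambda a G.
Proof.
intros Ha.
destruct (@ex_series_le R_AbsRing Cu_CompleteNormedModule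
  (fun j => mode lambda (a j) j) (fun j => Cmod (a j))) as [G HG]; [|exact Ha|].
- intros j; apply (Cu_norm_le (mode lambda (a j) j)), bounded_by_mode.
- exists G; intros eps He.
  destruct (HG (ball G (mkposreal _ He)) (locally_ball _ _)) as [N HN].
  exists N; intros n Hn; specialize (HN n Hn).
  apply Cu_norm_minus_bounded; exact HN.
Qed.

Lemma mode_series_pointwise (lambda : R) (a : nat -> C) (G : Cu) :
  mode_series_to lambda a G ->
  forall x, @is_series C_AbsRing C_NormedModule
    (fun j => a j * cis (x * INR (S j) * lambda)%R)%C (G x).
Proof.
intros HG x; apply is_Cseries_iff; intros eps He.
destruct (HG (eps / 2)) as [N HN]; [lra|].
exists N; intros n Hn; specialize (HN n Hn x).
rewrite Cu_sub_eq, mode_sum_eval in HN; lra.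
Qed.

Lemma near_mode_series (lambda : R) (a : nat -> C) (G : Cu) :
  mode_series_to lambda a G ->
  near lambda 0 G.
Proof.
intros HG eps He; destruct (HG eps He) as [N HN].
exists (mode_sum lambda a N); split; [apply trig_mode_sum|].
rewrite Rplus_0_l; apply Cu_sub_sym, HN; lia.
Qed.

Lemma A_space_near (lambda : R) (v : Cu) : A_space lambda v -> near lambda 0 v.
Proof.
intros [a [Ha Hv]].
destruct (mode_series lambda (fun j => a (S j)) Ha) as [G HG].
replace v with G; [exact (near_mode_series lambda _ G HG)|].
apply Cu_ext; intros x.
assert (H1 := Hv x); assert (H2 := mode_series_pointwise _ _ _ HG x).
apply C_eq_of_Cmod_le; intros eps He.
destruct (proj1 (is_Cseries_iff _ _) H1 (eps / 2)) as [N1 HN1]; [lra|].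
destruct (proj1 (is_Cseries_iff _ _) H2 (eps / 2)) as [N2 HN2]; [lra|].
specialize (HN1 (max N1 N2) (Nat.le_max_l _ _)).
specialize (HN2 (max N1 N2) (Nat.le_max_r _ _)).
unfold cis in HN2; set (s := sum_n _ _) in *.
replace (G x - v x)%C with ((s - v x) + - (s - G x))%C by ring.
eapply Rle_trans; [apply Cmod_triangle|]; rewrite Cmod_opp; lra.
Qed.

(** * The solution stays in the closed span of the modes *)

Lemma near_RInt (lambda : R) (g : R -> R) (f : R -> Cu) (a b J : R) (I : Cu) :
  a <= b -> (forall s, a <= s <= b -> near lambda (g s) (f s)) ->
  is_RInt g a b J -> is_RInt f a b I -> near lambda J I.
Proof.
intros Hab Hf HJ HI.
apply (closed_cone_RInt_majorant (V := Cu_NormedModule) (near lambda) g f a b J I);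
  try assumption.
- apply near_trig, trig_zero.
- intros r1 v1 r2 v2; apply near_plus.
- intros l r v Hl Hv.
  assert (H := near_scal lambda r (RtoC l) v Hv).
  rewrite Cmod_R, Rabs_right in H by lra; exact H.
- intros r v H; apply near_closed; intros eps He.
  destruct (H (mkposreal _ He)) as [r' [v' [Hn [Hr Hv]]]]; simpl in Hr, Hv.
  exists r', v'; split; [exact Hn | split].
  + apply Rabs_def2 in Hr; lra.
  + apply Cu_sub_sym, Cu_norm_minus_bounded, Hv.
Qed.

(** [continuous_on] is one-sided at the endpoints, so [u] is first extended by constants. *)
Lemma continuous_on_bounded (T : R) (u : R -> Cu) : 0 <= T ->
  continuous_on (fun t => 0 <= t <= T) u ->
  exists M, forall t, 0 <= t <= T -> bounded_by M (u t).
Proof.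
intros HT Hu.
set (clamp := fun t => Rmax 0 (Rmin t T)).
assert (Hc : forall t, 0 <= clamp t <= T).
{ intros t; unfold clamp; split; [apply Rmax_l|].
  apply Rmax_lub; [exact HT | apply Rmin_r]. }
assert (Hid : forall t, 0 <= t <= T -> clamp t = t).
{ intros t Ht; unfold clamp; rewrite Rmin_left, Rmax_right by lra; reflexivity. }
destruct (@bounded_continuity R_AbsRing Cu_NormedModule (fun t => u (clamp t)) 0 T)
  as [M HM].
- intros t Ht.
  apply filterlim_comp with (within (fun t => 0 <= t <= T) (locally (clamp t)));
    [|apply Hu, Hc].
  intros P [d Hd]; exists d; intros y Hy; apply Hd; [|apply Hc].
  unfold ball in *; simpl in *; unfold AbsRing_ball, abs, minus, plus, opp in *; simpl in *.
  eapply Rle_lt_trans; [|exact Hy].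
  unfold clamp, Rmax, Rmin; repeat destruct Rle_dec;
    unfold Rabs; repeat destruct Rcase_abs; lra.
- exists M; intros t Ht x; specialize (HM t Ht); simpl in HM.
  rewrite Hid in HM by exact Ht.
  eapply Rle_trans; [apply Cu_norm_ub | exact (Rlt_le _ _ HM)].
Qed.

Lemma is_RInt_exp_scal (k omega t : R) : omega <> 0 ->
  is_RInt (fun s => k * exp (omega * s)) 0 t (k / omega * (exp (omega * t) - 1)).
Proof.
intros Hw.
replace (k / omega * (exp (omega * t) - 1))
  with (minus (k / omega * exp (omega * t)) (k / omega * exp (omega * 0))).
- apply (is_RInt_derive (fun s => k / omega * exp (omega * s))).
  + intros x _; auto_derive; [trivial | field; exact Hw].
  + intros x _; apply (@ex_derive_continuous R_AbsRing R_NormedModule).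
    auto_derive; trivial.
- unfold minus, plus, opp; simpl; rewrite Rmult_0_r, exp_0; ring.
Qed.

(** The distance [d] of [u] to the closed span [X] of the modes satisfies
    [d t <= C0 * int_0^t d], because [X] is an algebra invariant under [U].  Gronwall's argument
    is run with the weight [exp (omega * t)], [omega = 2 * C0 + 1]: a bound
    [d s <= q * exp (omega * s)] implies the same bound with [q / 2], and this is iterated. *)
Lemma mild_solution_near (lambda T K : R) (n : nat) (U : R -> Cu -> Cu) (c : C)
    (u0 : Cu) (u : R -> Cu) : 0 <= T -> 0 <= K ->
  (forall t, 0 <= t <= T ->
    (forall v w, U t (Cu_plus v w) = Cu_plus (U t v) (U t w)) /\
    (forall M v, bounded_by M v -> bounded_by (K * M) (U t v)) /\
    (forall a j, trig_poly lambda (U t (mode lambda a j)))) ->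
  near lambda 0 u0 ->
  mild_solution U c (neg_pow (S n)) u0 T u ->
  forall t, 0 <= t <= T -> near lambda 0 (u t).
Proof.
intros HT HK HU Hu0 [Hcont Hmild].
destruct (continuous_on_bounded T u HT Hcont) as [M HM].
assert (HM0 : 0 <= M) by (eapply bounded_by_nonneg, (HM 0); lra).
destruct (near_pow lambda M n HM0) as [L [HL Hpow]].
assert (HUn : forall t r v, 0 <= t <= T -> near lambda r v -> near lambda (K * r) (U t v)).
{ intros t r v Ht; destruct (HU t Ht) as [H1 [H2 H3]].
  apply near_operator; assumption. }
assert (HB : forall r v, 0 <= r -> bounded_by M v -> near lambda r v ->
  near lambda (L * r) (neg_pow (S n) v)).
{ intros r v Hr Hb Hn; rewrite <- (Rmult_1_l (L * r)).
  replace 1 with (Cmod (-1)%C).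
  - apply near_scal, Hpow; assumption.
  - rewrite Cmod_R, Rabs_left; lra. }
set (C0 := Cmod c * (K * L)).
assert (HC0 : 0 <= C0)
  by (apply Rmult_le_pos; [apply Cmod_ge_0 | apply Rmult_le_pos; assumption]).
set (omega := 2 * C0 + 1).
assert (Hk : forall k t, 0 <= t <= T -> near lambda (M * (/ 2) ^ k * exp (omega * t)) (u t)).
{ induction k as [|k IH]; intros t Ht.
  - apply (near_le lambda M); [|apply near_bounded, HM, Ht].
    assert (1 <= exp (omega * t)).
    { apply Rle_trans with (1 + omega * t); [|apply exp_ineq1_le].
      unfold omega; nra. }
    simpl; nra.
  - destruct (Hmild t Ht) as [Hex ->].
    set (q := M * (/ 2) ^ k) in *.
    assert (Hq : 0 <= q) by (apply Rmult_le_pos; [exact HM0 | apply pow_le; lra]).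
    set (I := RInt _ 0 t).
    assert (HI : near lambda (K * L * q / omega * (exp (omega * t) - 1)) I).
    { apply (near_RInt lambda (fun s => K * L * q * exp (omega * s))
        (fun s => U (t - s) (neg_pow (S n) (u s))) 0 t); [lra| | |].
      - intros s Hs.
        replace (K * L * q * exp (omega * s)) with (K * (L * (q * exp (omega * s)))) by ring.
        apply HUn; [lra|]; apply HB.
        + apply Rmult_le_pos; [exact Hq | apply Rlt_le, exp_pos].
        + apply HM; lra.
        + apply IH; lra.
      - apply is_RInt_exp_scal; unfold omega; lra.
      - apply (RInt_correct (V := Cu_CompleteNormedModule)); exact Hex. }
    apply (near_scal lambda _ c) in HI.
    assert (H0 := HUn t 0 u0 Ht Hu0).
    assert (H := near_plus lambda _ _ _ _ H0 HI).
    revert H; apply near_le.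
    replace (M * (/ 2) ^ S k) with (q / 2) by (unfold q; simpl; field).
    replace (Cmod c * (K * L * q / omega * (exp (omega * t) - 1)))
      with (C0 / omega * (q * (exp (omega * t) - 1))) by (unfold C0, Rdiv; ring).
    assert (Hr : C0 / omega <= / 2).
    { apply Rmult_le_reg_r with omega; [unfold omega; lra|].
      replace (C0 / omega * omega) with C0 by (field; unfold omega; lra).
      unfold omega; lra. }
    assert (Hr0 : 0 <= C0 / omega)
      by (apply Rmult_le_pos; [exact HC0 | apply Rlt_le, Rinv_0_lt_compat; unfold omega; lra]).
    assert (He : 0 < exp (omega * t)) by apply exp_pos.
    assert (C0 / omega * (q * (exp (omega * t) - 1)) <= C0 / omega * (q * exp (omega * t)))
      by (apply Rmult_le_compat_l; nra).
    assert (C0 / omega * (q * exp (omega * t)) <= / 2 * (q * exp (omega * t)))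
      by (apply Rmult_le_compat_r; nra).
    lra. }
intros t Ht.
set (Z := M * exp (omega * t)).
assert (HZ : 0 <= Z) by (apply Rmult_le_pos; [exact HM0 | apply Rlt_le, exp_pos]).
intros eps He.
destruct (pow_lt_1_zero (/ 2)) with (y := eps / (2 * (Z + 1))) as [N HN].
{ rewrite Rabs_right; lra. }
{ apply Rdiv_lt_0_compat; lra. }
specialize (HN N (le_n N)).
rewrite Rabs_right in HN by (apply Rle_ge, pow_le; lra).
destruct (Hk N t Ht (eps / 2)) as [p [Hp Hb]]; [lra|].
exists p; split; [exact Hp|].
revert Hb; apply bounded_by_le.
replace (M * (/ 2) ^ N * exp (omega * t)) with ((/ 2) ^ N * Z) by (unfold Z; ring).
assert (He' : eps / 2 = eps / (2 * (Z + 1)) * (Z + 1)) by (field; lra).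
assert (Hd : 0 < eps / (2 * (Z + 1))) by (apply Rdiv_lt_0_compat; lra).
set (d := eps / (2 * (Z + 1))) in *.
assert ((/ 2) ^ N * Z <= d * Z) by (apply Rmult_le_compat_r; lra).
lra.
Qed.


(** * Fourier coefficients *)

Lemma cis_period (x : R) (m : nat) : cis (x + 2 * INR m * PI) = cis x.
Proof. rewrite !cis_eq, cos_period, sin_period; reflexivity. Qed.

Lemma cis_period_neg (x : R) (m : nat) : cis (x - 2 * INR m * PI) = cis x.
Proof.
rewrite <- (cis_period (x - 2 * INR m * PI) m); f_equal; ring.
Qed.

Definition period (lambda : R) : R := 2 * PI / Rabs lambda.

Lemma period_pos (lambda : R) : lambda <> 0 -> 0 < period lambda.
Proof.
intros H; assert (HPI := PI_RGT_0).
apply Rdiv_lt_0_compat; [lra | apply Rabs_pos_lt, H].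
Qed.

Lemma cis_mode_period (lambda x : R) (j k : nat) : lambda <> 0 ->
  cis ((x + period lambda) * ((INR j - INR k) * lambda)) =
  cis (x * ((INR j - INR k) * lambda)).
Proof.
intros Hl; unfold period.
destruct (Rle_or_lt 0 lambda) as [H | H];
  [rewrite Rabs_right by lra | rewrite Rabs_left by lra];
  destruct (le_lt_dec k j) as [Hjk | Hjk].
- rewrite <- (cis_period (x * ((INR j - INR k) * lambda)) (j - k)), minus_INR by exact Hjk; f_equal; field; lra.
- rewrite <- (cis_period_neg (x * ((INR j - INR k) * lambda)) (k - j)), minus_INR by lia; f_equal; field; lra.
- rewrite <- (cis_period_neg (x * ((INR j - INR k) * lambda)) (j - k)), minus_INR by exact Hjk; f_equal; field; lra.
- rewrite <- (cis_period (x * ((INR j - INR k) * lambda)) (k - j)), minus_INR by lia; f_equal; field; lra.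
Qed.

Lemma cis_continuous (k x : R) :
  @continuous R_UniformSpace C_R_CompleteNormedModule (fun t => cis (k * t)) x.
Proof. exact (Cu_continuous (mkCu _ (is_Cu_cis k)) x). Qed.

Lemma is_CInt_cis (k a b : R) : k <> 0 -> cis (b * k) = cis (a * k) ->
  is_CInt (fun x => cis (x * k)) a b (RtoC 0).
Proof.
intros Hk Hab; rewrite !cis_eq in Hab; injection Hab; intros Hs Hc.
apply is_CInt_pair; cbn [fst snd].
- apply (is_RInt_ext (fun x => cos (x * k))); [intros x _; rewrite cis_eq; reflexivity|].
  replace (fst (RtoC 0)) with (minus (sin (b * k) / k) (sin (a * k) / k))
    by (rewrite Hs; exact (minus_eq_zero _)).
  apply (is_RInt_derive (fun x => sin (x * k) / k)).
  + intros x _; auto_derive; [trivial | field; exact Hk].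
  + intros x _; apply (@ex_derive_continuous R_AbsRing R_NormedModule).
    auto_derive; trivial.
- apply (is_RInt_ext (fun x => sin (x * k))); [intros x _; rewrite cis_eq; reflexivity|].
  replace (snd (RtoC 0)) with (minus (- cos (b * k) / k) (- cos (a * k) / k))
    by (rewrite Hc; exact (minus_eq_zero _)).
  apply (is_RInt_derive (fun x => - cos (x * k) / k)).
  + intros x _; auto_derive; [trivial | field; exact Hk].
  + intros x _; apply (@ex_derive_continuous R_AbsRing R_NormedModule).
    auto_derive; trivial.
Qed.

Lemma is_CInt_ext (f g : R -> C) (a b : R) (l : C) :
  (forall x, f x = g x) -> is_CInt f a b l -> is_CInt g a b l.
Proof. intros H; apply is_RInt_ext; intros x _; apply H. Qed.

Lemma is_CInt_unique (f : R -> C) (a b : R) (l m : C) :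
  is_CInt f a b l -> is_CInt f a b m -> l = m.
Proof.
intros H1 H2; rewrite <- (@is_RInt_unique C_R_CompleteNormedModule f a b l H1).
exact (@is_RInt_unique C_R_CompleteNormedModule f a b m H2).
Qed.

Lemma is_CInt_plus (f g : R -> C) (a b : R) (l m : C) :
  is_CInt f a b l -> is_CInt g a b m -> is_CInt (fun x => f x + g x)%C a b (l + m)%C.
Proof. intros H1 H2; exact (is_RInt_plus (V := C_R_NormedModule) f g a b l m H1 H2). Qed.

Lemma is_CInt_bound (f : R -> C) (a b M : R) (l : C) : a <= b ->
  (forall x, Cmod (f x) <= M) -> is_CInt f a b l -> Cmod l <= (b - a) * M.
Proof.
intros Hab Hf Hl; rewrite Cmod_norm.
apply (norm_RInt_le_const (V := C_R_NormedModule) f a b l M Hab); [|exact Hl].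
intros x _; rewrite <- Cmod_norm; apply Hf.
Qed.

(** The base point [y] is free because the proof that a function vanishes at [x] uses a period
    with [x] in its interior; on the closed span of the modes the coefficient does not depend
    on [y], see [fourier_base_point]. *)
Definition fourier (lambda y : R) (j : nat) (v : Cu) : C :=
  (RtoC (/ period lambda) * @RInt C_R_CompleteNormedModule
    (fun x => v x * cis (- (x * INR (S j) * lambda))%R)%C y (y + period lambda)%R)%C.

Lemma fourier_correct (lambda y : R) (j : nat) (v : Cu) :
  is_CInt (fun x => RtoC (/ period lambda) * (v x * cis (- (x * INR (S j) * lambda))%R))%C
    y (y + period lambda) (fourier lambda y j v).
Proof.
apply is_CInt_Cmult, (@RInt_correct C_R_CompleteNormedModule).
apply ex_RInt_continuous; intros x _; apply continuous_Cmult; [apply Cu_continuous|].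
apply (continuous_ext (T := R_UniformSpace) (U := C_UniformSpace)
  (fun x => cis (- (INR (S j) * lambda) * x))); [|apply cis_continuous].
intros z; f_equal; ring.
Qed.

Lemma fourier_plus (lambda y : R) (j : nat) (v w : Cu) :
  fourier lambda y j (Cu_plus v w) = (fourier lambda y j v + fourier lambda y j w)%C.
Proof.
eapply is_CInt_unique; [apply fourier_correct|].
generalize (is_CInt_plus _ _ _ _ _ _ (fourier_correct lambda y j v)
  (fourier_correct lambda y j w)); apply is_CInt_ext.
intros x; simpl; ring.
Qed.

Lemma fourier_scal (lambda y : R) (j : nat) (c : C) (v : Cu) :
  fourier lambda y j (Cu_scal c v) = (c * fourier lambda y j v)%C.
Proof.
eapply is_CInt_unique; [apply fourier_correct|].
generalize (is_CInt_Cmult c _ _ _ _ (fourier_correct lambda y j v)); apply is_CInt_ext.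
intros x; simpl; ring.
Qed.

Lemma fourier_bound (lambda y M : R) (j : nat) (v : Cu) : lambda <> 0 ->
  bounded_by M v -> Cmod (fourier lambda y j v) <= M.
Proof.
intros Hl Hv; assert (HP := period_pos lambda Hl).
replace M with ((y + period lambda - y) * (/ period lambda * M)) by (field; lra).
refine (is_CInt_bound _ _ _ _ _ _ _ (fourier_correct lambda y j v)); [lra|].
intros x; rewrite !Cmod_mult, Cmod_cis, Cmod_R, Rmult_1_r, Rabs_right
  by (apply Rle_ge, Rlt_le, Rinv_0_lt_compat, HP).
apply Rmult_le_compat_l; [apply Rlt_le, Rinv_0_lt_compat, HP | apply Hv].
Qed.

Lemma fourier_mode (lambda y : R) (j k : nat) (c : C) : lambda <> 0 ->
  fourier lambda y j (mode lambda c k) = if Nat.eq_dec j k then c else 0%C.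
Proof.
intros Hl; assert (HP := period_pos lambda Hl).
eapply is_CInt_unique; [apply fourier_correct|].
apply is_CInt_ext with
  (fun x => RtoC (/ period lambda) * c * cis (x * ((INR k - INR j) * lambda))%R)%C.
{ intros x.
  change (mode lambda c k x) with (c * cis (x * INR (S k) * lambda)%R)%C.
  replace (x * ((INR k - INR j) * lambda))
    with (x * INR (S k) * lambda + - (x * INR (S j) * lambda)) by (rewrite !S_INR; ring).
  rewrite cis_plus; ring. }
destruct (Nat.eq_dec j k) as [<- | Hjk].
- apply is_CInt_ext with (fun _ => (RtoC (/ period lambda) * c)%C).
  { intros x; replace (x * ((INR j - INR j) * lambda)) with 0 by ring.
    rewrite cis_0; ring. }
  assert (H := is_RInt_const (V := C_R_NormedModule) y (y + period lambda)
    (RtoC (/ period lambda) * c)%C).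
  rewrite scal_R_Cmult, Cmult_assoc, <- RtoC_mult in H.
  replace ((y + period lambda - y) * / period lambda) with 1 in H by (field; lra).
  rewrite Cmult_1_l in H; exact H.
- replace (RtoC 0) with (RtoC (/ period lambda) * c * 0)%C by ring.
  apply is_CInt_Cmult, is_CInt_cis.
  + apply Rmult_integral_contrapositive_currified; [|exact Hl].
    intros H; apply Hjk, INR_eq; lra.
  + apply cis_mode_period, Hl.
Qed.

Definition bounded_additive (K : R) (phi : Cu -> C) : Prop :=
  (forall v w, phi (Cu_plus v w) = (phi v + phi w)%C) /\
  (forall M v, bounded_by M v -> Cmod (phi v) <= K * M).

Lemma bounded_additive_dist (K eps : R) (phi : Cu -> C) (v w : Cu) :
  bounded_additive K phi -> bounded_by eps (Cu_sub v w) ->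
  Cmod (phi v - phi w)%C <= K * eps.
Proof.
intros [Hp Hb] H; rewrite <- (Cu_sub_plus v w), Hp.
replace (phi (Cu_sub v w) + phi w - phi w)%C with (phi (Cu_sub v w)) by ring.
apply Hb, H.
Qed.

(** By continuity, identities between Fourier coefficients on the closed span of the modes
    need only be checked on modes. *)
Lemma bounded_additive_agree (lambda K1 K2 : R) (phi psi : Cu -> C) (v : Cu) :
  bounded_additive K1 phi -> bounded_additive K2 psi ->
  (forall c j, phi (mode lambda c j) = psi (mode lambda c j)) ->
  near lambda 0 v -> phi v = psi v.
Proof.
intros H1 H2 Hm Hv.
apply C_eq_of_Cmod_le; intros eps He.
assert (HK : forall K chi, bounded_additive K chi -> 0 <= K).
{ intros K chi [_ Hb]; rewrite <- (Rmult_1_r K).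
  eapply Rle_trans; [apply Cmod_ge_0 | apply (Hb 1 Cu_zero)].
  intros x; simpl; rewrite Cmod_0; lra. }
assert (HK1 := HK _ _ H1); assert (HK2 := HK _ _ H2).
destruct (Hv (eps / (K1 + K2 + 1))) as [p [Hp Hb]];
  [apply Rdiv_lt_0_compat; lra|].
rewrite Rplus_0_l in Hb.
assert (Hpp : phi p = psi p).
{ clear Hb; induction Hp as [c j | p q _ IHp _ IHq]; [apply Hm|].
  rewrite (proj1 H1), (proj1 H2), IHp, IHq; reflexivity. }
assert (B1 := bounded_additive_dist _ _ _ _ _ H1 Hb).
assert (B2 := bounded_additive_dist _ _ _ _ _ H2 Hb).
replace (phi v - psi v)%C with ((phi v - phi p) + - (psi v - psi p))%C
  by (rewrite Hpp; ring).
eapply Rle_trans; [apply Cmod_triangle|]; rewrite Cmod_opp.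
assert (He' : eps = eps / (K1 + K2 + 1) * (K1 + K2 + 1)) by (field; lra).
assert (0 < eps / (K1 + K2 + 1)) by (apply Rdiv_lt_0_compat; lra).
set (d := eps / (K1 + K2 + 1)) in *; lra.
Qed.

Lemma fourier_bounded_additive (lambda y : R) (j : nat) : lambda <> 0 ->
  bounded_additive 1 (fourier lambda y j).
Proof.
intros Hl; split; [apply fourier_plus|].
intros M v Hv; rewrite Rmult_1_l; apply fourier_bound; assumption.
Qed.

Lemma fourier_base_point (lambda y z : R) (j : nat) (v : Cu) : lambda <> 0 ->
  near lambda 0 v -> fourier lambda y j v = fourier lambda z j v.
Proof.
intros Hl; apply (bounded_additive_agree lambda 1 1);
  try (apply fourier_bounded_additive; exact Hl).
intros c k; rewrite !fourier_mode by exact Hl; reflexivity.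
Qed.

Lemma nonneg_RInt_0 (g : R -> R) (a b x : R) : a < x < b ->
  (forall t, 0 <= g t) -> (forall t, continuous g t) -> is_RInt g a b 0 -> g x = 0.
Proof.
intros Hx Hg Hc HI.
assert (Hex : forall c d, ex_RInt g c d)
  by (intros; apply (ex_RInt_continuous (V := R_CompleteNormedModule)); auto).
assert (Hge : forall c d, c <= d -> 0 <= RInt g c d)
  by (intros; apply RInt_ge_0; auto).
destruct (Req_dec (g x) 0) as [H | H]; [exact H | exfalso].
assert (Hgx : 0 < g x / 2) by (generalize (Hg x); lra).
destruct (Hc x (fun z => Rabs (z - g x) < g x / 2)) as [d Hd].
{ exists (mkposreal _ Hgx); intros z Hz; exact Hz. }
(* [g] exceeds half of [g x] on [[x, x + r]]. *)
set (r := Rmin (d / 2) (b - x)).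
assert (Hr : 0 < r) by (apply Rmin_glb_lt; [generalize (cond_pos d); lra | lra]).
assert (Hr1 : r <= d / 2) by apply Rmin_l.
assert (Hr2 : r <= b - x) by apply Rmin_r.
assert (H1 : 0 < RInt g x (x + r)).
{ apply RInt_gt_0; [lra | | intros; apply Hc].
  intros t Ht.
  assert (Ht' : Rabs (g t - g x) < g x / 2).
  { apply Hd; change (Rabs (t - x) < d); rewrite Rabs_right; [|lra].
    generalize (cond_pos d); lra. }
  apply Rabs_def2 in Ht'; lra. }
assert (E : RInt g a b = RInt g a x + (RInt g x (x + r) + RInt g (x + r) b)).
{ rewrite <- (RInt_Chasles g a x b) by apply Hex.
  rewrite <- (RInt_Chasles g x (x + r) b) by apply Hex. reflexivity. }
rewrite (is_RInt_unique g a b 0 HI) in E.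
generalize (Hge a x ltac:(lra)) (Hge (x + r) b ltac:(lra)); lra.
Qed.

Lemma is_Cu_conj (v : Cu) : is_Cu (fun x => Cconj (v x)).
Proof.
destruct (Cu_is_Cu v) as [[M HM] Hv]; split.
- exists M; intros x; rewrite Cmod_conj; apply HM.
- intros eps; destruct (Hv eps) as [d Hd]; exists d; intros x y Hxy.
  rewrite <- Cminus_conj, Cmod_conj; apply Hd, Hxy.
Qed.

Definition Cu_conj (v : Cu) : Cu := mkCu _ (is_Cu_conj v).

Lemma Cu_ex_CInt (v : Cu) (a b : R) : exists I : C, is_CInt v a b I.
Proof.
exact (@ex_RInt_continuous C_R_CompleteNormedModule v a b
  (fun x _ => Cu_continuous v x)).
Qed.

Lemma orthogonal_trig (lambda y : R) (h p : Cu) : lambda <> 0 ->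
  (forall j, fourier lambda y j h = 0%C) -> trig_poly lambda p ->
  is_CInt (Cu_mult h (Cu_conj p)) y (y + period lambda) (RtoC 0).
Proof.
intros Hl Hh Hp; assert (HP := period_pos lambda Hl).
induction Hp as [c j | p q _ IHp _ IHq].
- assert (H := fourier_correct lambda y j h); rewrite Hh in H.
  apply (is_CInt_Cmult (RtoC (period lambda) * Cconj c)%C) in H.
  rewrite Cmult_0_r in H; revert H; apply is_CInt_ext; intros x.
  change (Cu_mult h (Cu_conj (mode lambda c j)) x)
    with (h x * Cconj (c * cis (x * INR (S j) * lambda)%R))%C.
  rewrite Cmult_conj.
  replace (Cconj (cis (x * INR (S j) * lambda))) with (cis (- (x * INR (S j) * lambda))).
  + replace (Cconj c) with (RtoC (period lambda * / period lambda) * Cconj c)%C at 2.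
    * rewrite RtoC_mult; ring.
    * replace (period lambda * / period lambda) with 1 by (field; lra); ring.
  + rewrite !cis_eq, cos_neg, sin_neg; reflexivity.
- rewrite <- (Cplus_0_r 0).
  generalize (is_CInt_plus _ _ _ _ _ _ IHp IHq); apply is_CInt_ext.
  intros x; simpl; rewrite Cplus_conj; ring.
Qed.

(** Over a period [int |h|^2 = int h (h - p)^*] for every polynomial [p] in the modes, by
    [orthogonal_trig]; choosing [p] uniformly close to [h] gives [int |h|^2 = 0]. *)
Lemma fourier_injective (lambda : R) (h : Cu) : lambda <> 0 -> near lambda 0 h ->
  (forall j, fourier lambda 0 j h = 0%C) -> forall x, h x = 0%C.
Proof.
intros Hl Hn Hh x; assert (HP := period_pos lambda Hl).
(* The period is centred at [x]. *)
set (y := x - period lambda / 2).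
assert (Hy : forall j, fourier lambda y j h = 0%C)
  by (intros j; rewrite (fourier_base_point lambda y 0); auto).
set (q := Cu_mult h (Cu_conj h)).
destruct (Cu_ex_CInt q y (y + period lambda)) as [I HI].
assert (HIz : I = 0%C).
{ apply C_eq_of_Cmod_le; intros eps He.
  replace (I - 0)%C with I by ring.
  assert (HM := Cu_norm_ub h); set (M := Cu_norm h) in HM.
  assert (HM0 : 0 <= M) by (eapply Rle_trans; [apply (Cmod_ge_0 (h 0)) | apply HM]).
  assert (Hd : 0 < period lambda * M + 1) by nra.
  destruct (Hn (eps / (period lambda * M + 1))) as [p [Hp Hb]];
    [apply Rdiv_lt_0_compat; lra|].
  rewrite Rplus_0_l in Hb.
  assert (H0 := orthogonal_trig lambda y h p Hl Hy Hp).
  assert (H1 : is_CInt (Cu_mult h (Cu_conj (Cu_sub h p))) y (y + period lambda) I).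
  { assert (H2 := is_CInt_plus _ _ _ _ _ _ HI (is_CInt_Cmult (-1)%C _ _ _ _ H0)).
    replace (I + -1 * 0)%C with I in H2 by ring.
    revert H2; apply is_CInt_ext; intros z; unfold q; simpl.
    rewrite Cplus_conj, Cmult_conj.
    replace (Cconj (-1)%C) with (RtoC (-1))
      by (apply injective_projections; simpl; ring).
    ring. }
  assert (He' : eps = eps / (period lambda * M + 1) * (period lambda * M + 1))
    by (field; lra).
  assert (Hde : 0 < eps / (period lambda * M + 1)) by (apply Rdiv_lt_0_compat; lra).
  set (d := eps / (period lambda * M + 1)) in *.
  apply Rle_trans with ((y + period lambda - y) * (M * d)).
  - refine (is_CInt_bound _ _ _ _ _ _ _ H1); [lra|].
    intros z; change (Cmod (h z * Cconj (Cu_sub h p z))%C <= M * d).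
    rewrite Cmod_mult, Cmod_conj.
    apply Rmult_le_compat; auto using Cmod_ge_0.
  - rewrite He'; nra. }
rewrite HIz in HI; apply is_CInt_fst in HI; simpl in HI.
assert (Hsq : forall z, fst (q z) = Cmod (h z) ^ 2).
{ intros z; rewrite Cmod2_alt; unfold q, Re, Im; simpl; ring. }
apply Cmod_eq_0.
assert (H2 : Cmod (h x) ^ 2 = 0); [|apply Rsqr_0_uniq; unfold Rsqr; nra].
rewrite <- Hsq.
apply (nonneg_RInt_0 (fun z => fst (q z)) y (y + period lambda) x).
- unfold y; lra.
- intros z; rewrite Hsq; apply pow2_ge_0.
- intros z; apply (continuous_comp q (fun c : C => fst c)).
  + exact (Cu_continuous q z).
  + apply continuous_fst.
- exact HI.
Qed.

Lemma fourier_mode_sum (lambda y : R) (a : nat -> C) (j n : nat) : lambda <> 0 ->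
  fourier lambda y j (mode_sum lambda a n) = if le_lt_dec j n then a j else 0%C.
Proof.
intros Hl; induction n as [|n IH]; unfold mode_sum in *.
- rewrite sum_O, fourier_mode by exact Hl.
  destruct (Nat.eq_dec j 0) as [->|]; destruct (le_lt_dec _ _); reflexivity || lia.
- rewrite sum_Sn; change plus with Cu_plus.
  rewrite fourier_plus, IH, fourier_mode by exact Hl.
  destruct (Nat.eq_dec j (S n)) as [->|];
    repeat destruct (le_lt_dec _ _); try lia; ring.
Qed.

(** The Fourier series of [v] converges uniformly to some [G] with the same coefficients as
    [v], and [fourier_injective] applies to [v - G]. *)
Lemma near_summable_A_space (lambda : R) (v : Cu) : lambda <> 0 -> near lambda 0 v ->
  ex_series (fun j => Cmod (fourier lambda 0 j v)) -> A_space lambda v.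
Proof.
intros Hl Hn Hs.
set (a := fun j => fourier lambda 0 j v).
destruct (mode_series lambda a Hs) as [G HG].
assert (Hc : forall j, fourier lambda 0 j G = a j).
{ intros j.
  apply C_eq_of_Cmod_le; intros eps He.
  destruct (HG eps He) as [N HN]; specialize (HN (max N j) (Nat.le_max_l _ _)).
  assert (Hm := fourier_mode_sum lambda 0 a j (max N j) Hl).
  destruct (le_lt_dec j (max N j)) as [_ | H];
    [|generalize (Nat.le_max_r N j); lia].
  rewrite <- Hm, <- (Rmult_1_l eps).
  apply bounded_additive_dist; [apply fourier_bounded_additive, Hl|].
  apply Cu_sub_sym, HN. }
assert (Hv : v = G).
{ apply Cu_ext; intros x.
  assert (H : Cu_sub v G x = 0%C).
  { apply (fourier_injective lambda); [exact Hl | |].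
    - replace 0 with (0 + Cmod (-1)%C * 0) by ring.
      apply near_plus; [exact Hn|].
      apply near_scal, (near_mode_series lambda a), HG.
    - intros j; unfold Cu_sub, Cu_opp; rewrite fourier_plus, fourier_scal, Hc.
      unfold a; ring. }
  rewrite Cu_sub_eq in H.
  replace (v x) with (v x - G x + G x)%C by ring; rewrite H; ring. }
(* [A_space] numbers the coefficients from 1. *)
exists (fun m => a (pred m)); split; [exact Hs|].
intros x; rewrite Hv.
exact (mode_series_pointwise lambda a G HG x).
Qed.

Lemma fourier_RInt (lambda y : R) (j : nat) (g : R -> R) (f : R -> Cu) (a b J : R)
    (I : Cu) : lambda <> 0 -> a <= b ->
  (forall s, a <= s <= b -> Cmod (fourier lambda y j (f s)) <= g s) ->
  is_RInt g a b J -> is_RInt f a b I -> Cmod (fourier lambda y j I) <= J.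
Proof.
intros Hl Hab Hf HJ HI.
apply (closed_cone_RInt_majorant (V := Cu_NormedModule)
  (fun r v => Cmod (fourier lambda y j v) <= r) g f a b J I); try assumption.
- apply fourier_bound; [exact Hl|]; intros x.
  change (Cmod 0 <= 0); rewrite Cmod_0; lra.
- intros r1 v1 r2 v2 H1 H2; change plus with Cu_plus; rewrite fourier_plus.
  eapply Rle_trans; [apply Cmod_triangle | lra].
- intros l r v H0 H; change (scal l v) with (Cu_scal (RtoC l) v).
  rewrite fourier_scal, Cmod_mult, Cmod_R, Rabs_right by lra.
  apply Rmult_le_compat_l; assumption.
- intros r v H; apply le_epsilon; intros eps He.
  assert (He2 : 0 < eps / 2) by lra.
  destruct (H (mkposreal _ He2)) as [r' [v' [Hv [Hr Hb]]]]; simpl in Hr, Hb.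
  apply Rabs_def2 in Hr; apply Cu_norm_minus_bounded, Cu_sub_sym in Hb.
  apply (bounded_additive_dist 1 _ _ _ _ (fourier_bounded_additive lambda y j Hl)) in Hb.
  replace (fourier lambda y j v)
    with (fourier lambda y j v' + (fourier lambda y j v - fourier lambda y j v'))%C by ring.
  eapply Rle_trans; [apply Cmod_triangle | lra].
Qed.


(** * Decay of the Fourier coefficients of the solution *)

Lemma exp_nondecreasing (x y : R) : x <= y -> exp x <= exp y.
Proof.
intros [H | ->]; [apply Rlt_le, exp_increasing, H | apply Rle_refl].
Qed.

Lemma ex_series_inv_square : ex_series (fun j => / INR (S j) ^ 2).
Proof.
apply (@ex_series_le R_AbsRing R_CompleteNormedModule _
  (fun j => 2 * (/ INR (S j) - / INR (S (S j))))).
- intros j; change (Rabs (/ INR (S j) ^ 2) <= 2 * (/ INR (S j) - / INR (S (S j)))).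
  assert (Hj := pos_INR j).
  rewrite !S_INR; set (y := INR j) in *.
  rewrite Rabs_right by (apply Rle_ge, Rlt_le, Rinv_0_lt_compat, pow_lt; lra).
  replace (2 * (/ (y + 1) - / (y + 1 + 1))) with (2 * (y + 1) / (y + 1 + 1) * / (y + 1) ^ 2)
    by (field; lra).
  rewrite <- (Rmult_1_l (/ (y + 1) ^ 2)) at 1.
  apply Rmult_le_compat_r; [apply Rlt_le, Rinv_0_lt_compat, pow_lt; lra|].
  apply (Rle_div_r _ _ (y + 1 + 1)); lra.
- exists 2; change (is_lim_seq (sum_n (fun j => 2 * (/ INR (S j) - / INR (S (S j))))) 2).
  apply (is_lim_seq_ext (fun n => 2 * (1 - / INR (S (S n))))).
  + intros n; symmetry; induction n as [|n IH].
    * rewrite sum_O; simpl; field.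
    * rewrite sum_Sn, IH; unfold plus; simpl plus.
      assert (INR (S (S n)) <> 0) by (apply not_0_INR; lia).
      assert (INR (S (S (S n))) <> 0) by (apply not_0_INR; lia).
      change (2 * (1 - / INR (S (S n))) + 2 * (/ INR (S (S n)) - / INR (S (S (S n)))) =
        2 * (1 - / INR (S (S (S n))))); ring.
  + replace (Finite 2) with (Finite (2 * (1 - 0))) by (f_equal; ring).
    apply (is_lim_seq_scal_l _ 2 (1 - 0)).
    apply is_lim_seq_minus'; [apply is_lim_seq_const|].
    apply (is_lim_seq_incr_1 (fun n => / INR (S n))), (is_lim_seq_incr_1 (fun n => / INR n)).
    apply (is_lim_seq_inv INR p_infty); [apply is_lim_seq_INR | discriminate].
Qed.

Lemma is_RInt_resolvent_square (C0 k t : R) : 0 < k -> 0 <= t ->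
  is_RInt (fun s => C0 / (1 + k * (t - s)) ^ 2) 0 t (C0 / k * (1 - / (1 + k * t))).
Proof.
intros Hk Ht.
assert (Hpos : forall s, Rmin 0 t <= s <= Rmax 0 t -> 0 < 1 + k * (t - s)).
{ intros s; rewrite Rmin_left, Rmax_right by exact Ht; intros Hs; nra. }
assert (H0 : 0 < 1 + k * t) by nra.
replace (C0 / k * (1 - / (1 + k * t)))
  with (minus (C0 / (k * (1 + k * (t - t)))) (C0 / (k * (1 + k * (t - 0))))).
- apply (is_RInt_derive (fun s => C0 / (k * (1 + k * (t - s))))).
  + intros x Hx; specialize (Hpos x Hx).
    auto_derive; [|field]; nra.
  + intros x Hx; specialize (Hpos x Hx).
    apply (@ex_derive_continuous R_AbsRing R_NormedModule); auto_derive.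
    rewrite Rmult_1_r; nra.
- change (C0 / (k * (1 + k * (t - t))) + - (C0 / (k * (1 + k * (t - 0)))) =
    C0 / k * (1 - / (1 + k * t))).
  rewrite Rminus_diag, Rminus_0_r, Rmult_0_r, Rplus_0_r; field; lra.
Qed.

Lemma bounded_by_neg_pow (M : R) (n : nat) (v : Cu) :
  bounded_by M v -> bounded_by (M ^ n) (neg_pow n v).
Proof.
intros H x; unfold neg_pow, Cu_opp; simpl.
rewrite Cmod_mult, Cmod_R, Rabs_left, Cmod_pow by lra.
assert (Cmod (v x) ^ n <= M ^ n)
  by (apply pow_incr; split; [apply Cmod_ge_0 | apply H]).
lra.
Qed.

Lemma near_neg_pow (lambda M : R) (n : nat) (v : Cu) : bounded_by M v ->
  near lambda 0 v -> near lambda 0 (neg_pow (S n) v).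
Proof.
intros Hb Hn; destruct (near_pow lambda M n (bounded_by_nonneg M v Hb)) as [L [_ HL]].
specialize (HL 0 v (Rle_refl 0) Hb Hn).
apply (near_scal lambda _ (-1)%C) in HL; rewrite !Rmult_0_r in HL; exact HL.
Qed.

(** The Fourier coefficient of order [j] and the multiplication by the [j]-th multiplier are
    continuous, so it suffices to compare them on modes. *)
Lemma fourier_semigroup (alpha beta gamma lambda : R) : 0 < alpha -> lambda <> 0 ->
  exists K, 0 <= K /\ forall t y M j v, 0 <= t -> bounded_by M v -> near lambda 0 v ->
    Cmod (fourier lambda y j (semigroup alpha beta gamma t v)) <=
    K * exp (gamma * t) * M / (1 + (INR (S j) * lambda) ^ 2 * t) ^ 2.
Proof.
intros Ha Hl.
destruct (semigroup_multiplier alpha beta gamma Ha) as [K [HK HU]].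
exists K; split; [exact HK|]; intros t y M j v Ht Hb Hn.
destruct (HU t Ht) as [Hp [HUb [mu [Hmu Hmode]]]].
assert (HF := fourier_bounded_additive lambda y j Hl).
set (k := INR (S j) * lambda) in *.
rewrite (bounded_additive_agree lambda (K * exp (gamma * t)) (Cmod (mu k))
  (fun w => fourier lambda y j (semigroup alpha beta gamma t w))
  (fun w => mu k * fourier lambda y j w)%C v).
- rewrite Cmod_mult.
  replace (K * exp (gamma * t) * M / (1 + k ^ 2 * t) ^ 2)
    with (K * exp (gamma * t) / (1 + k ^ 2 * t) ^ 2 * M) by (unfold Rdiv; ring).
  apply Rmult_le_compat; auto using Cmod_ge_0.
  apply fourier_bound; assumption.
- split.
  + intros a b; rewrite Hp; apply fourier_plus.
  + intros N w Hw; apply fourier_bound; auto.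
- split.
  + intros a b; rewrite fourier_plus; ring.
  + intros N w Hw; rewrite Cmod_mult.
    apply Rmult_le_compat_l; [apply Cmod_ge_0 | apply fourier_bound; assumption].
- intros c i; rewrite Hmode, !fourier_mode by exact Hl.
  destruct (Nat.eq_dec j i) as [<- | _]; [reflexivity | ring].
- exact Hn.
Qed.

(** In Duhamel's formula the free evolution contributes [O(1 / (k^2 t))] and the integral term
    [O(1 / k^2)], where [k = (j+1) lambda]; the nonlinearity enters through its sup norm
    only. *)
Lemma mild_solution_fourier_decay (alpha beta gamma lambda t : R) (n : nat) (c : C)
    (u0 : Cu) (u : R -> Cu) : 0 < alpha -> 0 <= gamma -> lambda <> 0 -> 0 < t ->
  mild_solution (semigroup alpha beta gamma) c (neg_pow (S n)) u0 t u ->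
  near lambda 0 u0 -> (forall s, 0 <= s <= t -> near lambda 0 (u s)) ->
  exists D, forall j, Cmod (fourier lambda 0 j (u t)) <= D * / INR (S j) ^ 2.
Proof.
intros Ha Hg Hl Ht [Hcont Hmild] Hu0 Hu.
destruct (continuous_on_bounded t u (Rlt_le _ _ Ht) Hcont) as [M HM].
assert (HM0 : 0 <= M) by (eapply bounded_by_nonneg, (HM 0); lra).
destruct (fourier_semigroup alpha beta gamma lambda Ha Hl) as [K [HK HU]].
set (E := exp (gamma * t)).
assert (HE : 0 < E) by apply exp_pos.
assert (HKE : 0 <= K * E) by (apply Rmult_le_pos; lra).
assert (Hl2 : 0 < lambda ^ 2) by (apply pow2_gt_0, Hl).
set (M0 := Cu_norm u0); assert (HM0' := Cu_norm_ub u0 : bounded_by M0 u0).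
assert (HM0n := bounded_by_nonneg _ _ HM0').
set (M1 := M ^ S n); assert (HM1 : 0 <= M1) by (apply pow_le, HM0).
exists ((K * E * M0 / t + Cmod c * (K * E * M1)) / lambda ^ 2); intros j.
set (m := INR (S j)); assert (Hm : 0 < m) by (apply lt_0_INR; lia).
set (k2 := (m * lambda) ^ 2).
assert (Hk2 : 0 < k2) by (unfold k2; rewrite Rpow_mult_distr; apply Rmult_lt_0_compat; nra).
destruct (Hmild t) as [Hex ->]; [lra|].
set (I := RInt _ 0 t).
assert (HI : Cmod (fourier lambda 0 j I) <= K * E * M1 / k2).
{ apply Rle_trans with (K * E * M1 / k2 * (1 - / (1 + k2 * t))).
  - apply (fourier_RInt lambda 0 j (fun s => K * E * M1 / (1 + k2 * (t - s)) ^ 2)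
      (fun s => semigroup alpha beta gamma (t - s) (neg_pow (S n) (u s))) 0 t);
      [exact Hl | lra | | |].
    + intros s Hs.
      eapply Rle_trans.
      { apply (HU (t - s) 0 M1); [lra | |].
        - apply bounded_by_neg_pow, HM, Hs.
        - apply (near_neg_pow lambda M); [apply HM, Hs | apply Hu, Hs]. }
      fold m; fold k2.
      apply Rmult_le_compat_r;
        [apply Rlt_le, Rinv_0_lt_compat, pow_lt; nra|].
      apply Rmult_le_compat_r; [exact HM1|].
      apply Rmult_le_compat_l; [exact HK|].
      apply exp_nondecreasing; nra.
    + apply is_RInt_resolvent_square; lra.
    + apply (RInt_correct (V := Cu_CompleteNormedModule)); exact Hex.
  - assert (0 < / (1 + k2 * t)) by (apply Rinv_0_lt_compat; nra).
    assert (0 <= K * E * M1 / k2).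
    { apply Rmult_le_pos; [nra | apply Rlt_le, Rinv_0_lt_compat, Hk2]. }
    nra. }
assert (H0 : Cmod (fourier lambda 0 j (semigroup alpha beta gamma t u0))
  <= K * E * M0 / (k2 * t)).
{ eapply Rle_trans; [apply (HU t 0 M0); [lra | exact HM0' | exact Hu0]|].
  fold m; fold k2; fold E.
  apply Rmult_le_compat_l; [nra|].
  assert (0 < k2 * t) by nra.
  apply Rinv_le_contravar; nra. }
change plus with Cu_plus; rewrite fourier_plus, fourier_scal.
eapply Rle_trans; [apply Cmod_triangle|]; rewrite Cmod_mult.
apply (Rmult_le_compat_l (Cmod c)) in HI; [|apply Cmod_ge_0].
replace ((K * E * M0 / t + Cmod c * (K * E * M1)) / lambda ^ 2 * / m ^ 2)
  with (K * E * M0 / (k2 * t) + Cmod c * (K * E * M1 / k2))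
  by (unfold k2; field; lra).
lra.
Qed.

(** For [lambda = 0] every mode is constant, hence so is [v], and [v] is its own one-term
    expansion. *)
Lemma near_0_A_space (v : Cu) : near 0 0 v -> A_space 0 v.
Proof.
intros Hn.
assert (Hc : forall x, v x = v 0).
{ intros x.
  apply C_eq_of_Cmod_le; intros eps He.
  destruct (Hn (eps / 2)) as [p [Hp Hb]]; [lra|].
  assert (Hpx : p x = p 0).
  { clear Hb; induction Hp as [c j | p q _ IHp _ IHq].
    - change ((c * cis (x * INR (S j) * 0)%R)%C = (c * cis (0 * INR (S j) * 0)%R)%C).
      do 2 f_equal; ring.
    - simpl; rewrite IHp, IHq; reflexivity. }
  assert (H1 := Hb x); assert (H2 := Hb 0); rewrite Cu_sub_eq in H1, H2.
  replace (v x - v 0)%C with ((v x - p x) + - (v 0 - p 0))%C by (rewrite Hpx; ring).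
  eapply Rle_trans; [apply Cmod_triangle|]; rewrite Cmod_opp; lra. }
set (a := fun j => match j with O => v 0 | S _ => RtoC 0 end).
assert (Ha : ex_series (fun j => Cmod (a j))).
{ apply (ex_series_incr_1 (fun j => Cmod (a j))).
  apply (@ex_series_le R_AbsRing R_CompleteNormedModule _ (fun j => / INR (S j) ^ 2));
    [|apply ex_series_inv_square].
  intros j; simpl a; change (Rabs (Cmod 0) <= / INR (S j) ^ 2).
  rewrite Cmod_0, Rabs_R0; apply Rlt_le, Rinv_0_lt_compat, pow_lt, lt_0_INR; lia. }
destruct (mode_series 0 a Ha) as [G HG].
assert (Hs : forall n x, mode_sum 0 a n x = v x).
{ intros n x; rewrite mode_sum_eval; induction n as [|n IH].
  - rewrite sum_O; simpl a; rewrite Rmult_0_r, cis_0, (Hc x); ring.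
  - rewrite sum_Sn, IH; simpl a; change plus with Cplus; ring. }
exists (fun m => a (pred m)); split; [exact Ha|]; intros x.
apply is_Cseries_iff; intros eps He; exists 0%nat; intros n _.
change (Cmod (@sum_n C_AbelianMonoid
  (fun j => (a j * cis (x * INR (S j) * 0)%R)%C) n - v x)%C < eps).
rewrite <- mode_sum_eval, Hs.
replace (v x - v x)%C with (RtoC 0) by ring; rewrite Cmod_0; exact He.
Qed.

Theorem theorem4p3 (alpha beta gamma a b lambda : R) (n : nat)
    (Halpha : 0 < alpha) (Hbeta : 0 < beta) (Hgamma : 0 <= gamma)
    (Ha : 0 < a) (Hb : 0 < b) (Hn : (2 < n)%nat)
    (u0 : Cu) (Hu0 : A_space lambda u0)
    (Tstar : Rbar) (u : R -> Cu)
    (Hu : maximal_mild_solution (semigroup alpha beta gamma) (a, b) (neg_pow n) u0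
            Tstar u) :
  forall t : R, 0 < t -> Rbar_lt t Tstar -> A_space lambda (u t).
Proof.
intros t Ht HtT; destruct Hu as [_ [Hsol _]]; specialize (Hsol t HtT).
destruct n as [|n]; [lia|].
assert (Hnear0 := A_space_near lambda u0 Hu0).
assert (Hnear : forall s, 0 <= s <= t -> near lambda 0 (u s)).
{ destruct (semigroup_multiplier alpha beta gamma Halpha) as [K [HK HU]].
  apply (mild_solution_near lambda t (K * exp (gamma * t)) n
    (semigroup alpha beta gamma) (a, b) u0 u); [lra | | | exact Hnear0 | exact Hsol].
  - apply Rmult_le_pos; [exact HK | apply Rlt_le, exp_pos].
  - intros s Hs; destruct (HU s (proj1 Hs)) as [Hp [Hbd [mu [_ Hmode]]]].
    split; [exact Hp | split].
    + intros M v Hv.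
      apply (bounded_by_le (K * exp (gamma * s) * M)); [|apply Hbd, Hv].
      apply Rmult_le_compat_r; [exact (bounded_by_nonneg M v Hv)|].
      apply Rmult_le_compat_l; [exact HK|].
      apply exp_nondecreasing; nra.
    + intros c j; rewrite Hmode; constructor. }
assert (Hnt : near lambda 0 (u t)) by (apply Hnear; lra).
destruct (Req_dec lambda 0) as [-> | Hl]; [apply near_0_A_space, Hnt|].
apply near_summable_A_space; [exact Hl | exact Hnt|].
destruct (mild_solution_fourier_decay alpha beta gamma lambda t n (a, b) u0 u
  Halpha Hgamma Hl Ht Hsol Hnear0 Hnear) as [D HD].
apply (@ex_series_le R_AbsRing R_CompleteNormedModule _ (fun j => D * / INR (S j) ^ 2)).
- intros j; change (Rabs (Cmod (fourier lambda 0 j (u t))) <= D * / INR (S j) ^ 2).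
  rewrite Rabs_right; [apply HD | apply Rle_ge, Cmod_ge_0].
- exact (ex_series_scal_l D _ ex_series_inv_square).
Qed.
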